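(* Let $U$ be a semi-algebraic connected open subset of $\mathbb{R}^n$ with coordinates $x=(x_1,\dots,x_n)$, and let $f$ be a real analytic function on $U$. Then the following conditions are equivalent: (1) $f$ is a Nash function on $U$. (2) There exists a Nash function $g\in\mathcal N(U)$, not identically zero on $U$, such that $$g\Big(\mathbf d f-\sum_{i=1}^n \frac{\partial f}{\partial x_i}\,\mathbf d x_i\Big)=0$$ in the module $\Omega_{\mathcal E(U)}$ of Kähler differentials of $\mathcal E(U)$. (3) $\mathbf d f=\sum_{i=1}^n \frac{\partial f}{\partial x_i}\,\mathbf d x_i$ in the module $\Omega_{\widetilde{\mathcal E}(U)}$ of Kähler differentials of $\widetilde{\mathcal E}(U)$. (4) There exist $f_1,\dots,f_n\in\widetilde{\mathcal E}(U)$ such that $\mathbf d f=\sum_{i=1}^n f_i\,\mathbf d x_i$ in $\Omega_{\widetilde{\mathcal E}(U)}$.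
   Context: A Nash function on an open set $U\subset\mathbb{R}^n$ is a real analytic function $f$ on $U$ for which there is a non-zero polynomial $P(x,y)\in\mathbb{R}[x_1,\dots,x_n,y]$ with $P(x,f(x))=0$ for all $x\in U$. $\mathcal E(U)$ denotes the $\mathbb{R}$-algebra of $C^\infty$ functions on $U$ and $\mathcal N(U)$ the subalgebra of Nash functions. For an $\mathbb{R}$-algebra $A$, $\Omega_A$ is the module of Kähler differentials: the quotient of the free $A$-module on symbols $\mathbf d h$ ($h\in A$) by the submodule generated by all $\mathbf d(h+k)-\mathbf d h-\mathbf d k$, $\mathbf d(\lambda \ell)-\lambda\mathbf d \ell$, $\mathbf d(pq)-p\,\mathbf d q-q\,\mathbf d p$ ($h,k,\ell,p,q\in A$, $\lambda\in\mathbb{R}$), with $\mathbf d:A\to\Omega_A$ sending $h$ to the class of $\mathbf d h$. Here $x_i$ denotes the coordinate function. Let $S\subset\mathcal N(U)$ be the multiplicative set of Nash functions not identically zero on $U$, and $\widetilde{\mathcal E}(U)=\mathcal E(U)_S$ the localization of $\mathcal E(U)$ at $S$. *)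

(* Defs.v *)
From HB Require Import structures.
From mathcomp Require Import all_boot all_order all_algebra.
From mathcomp Require Import all_classical all_reals all_analysis.
From Stdlib Require Lists.List.
From mathcomp Require mpoly.
Import (canonicals, coercions) mpoly.

Set Implicit Arguments.
Unset Strict Implicit.
Unset Printing Implicit Defensive.

Import Order.TTheory GRing.Theory Num.Theory.
Import numFieldNormedType.Exports.
Local Open Scope classical_set_scope.
Local Open Scope ring_scope.

Section Defs.
Context {RR : realType}.

Local Notation Rn n := 'rV[RR]_n.

Definition xcoord {n : nat} (i : 'I_n) : Rn n -> RR := fun x => x ord0 i.

Inductive sa_formula (n : nat) : Type :=
| SAeq  of mpoly.mpoly n RR
| SAgt  of mpoly.mpoly n RR
| SAnot of sa_formula n
| SAand of sa_formula n & sa_formula n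
| SAor  of sa_formula n & sa_formula n.

Fixpoint sa_holds {n : nat} (phi : sa_formula n) (x : Rn n) : Prop :=
  match phi with
  | SAeq p => mpoly.meval (fun i => x ord0 i) p = 0
  | SAgt p => 0 < mpoly.meval (fun i => x ord0 i) p
  | SAnot psi => ~ sa_holds psi x
  | SAand a b => sa_holds a x /\ sa_holds b x
  | SAor a b => sa_holds a x \/ sa_holds b x
  end.

Definition semialgebraic {n : nat} (U : set (Rn n)) : Prop :=
  exists phi : sa_formula n, forall x, U x <-> sa_holds phi x.

Definition monomial {n : nat} (a x : Rn n) (alpha : 'I_n -> nat) : RR :=
  \prod_(i < n) (x ord0 i - a ord0 i) ^+ alpha i.

Definition box_sum {n : nat} (c : ('I_n -> nat) -> RR) (a x : Rn n) (N : nat) : RR :=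
  \sum_(alpha : {ffun 'I_n -> 'I_N.+1})
     c (fun i => nat_of_ord (alpha i)) * monomial a x (fun i => nat_of_ord (alpha i)).

Definition box_abs_sum {n : nat} (c : ('I_n -> nat) -> RR) (a x : Rn n) (N : nat) : RR :=
  \sum_(alpha : {ffun 'I_n -> 'I_N.+1})
     `|c (fun i => nat_of_ord (alpha i))| * `|monomial a x (fun i => nat_of_ord (alpha i))|.

Definition analytic_on {n : nat} (U : set (Rn n)) (f : Rn n -> RR) : Prop :=
  forall a, U a ->
    exists c : ('I_n -> nat) -> RR, exists2 r : RR, 0 < r &
      forall x, ball a r x ->
        (exists M : RR, forall N, box_abs_sum c a x N <= M) /\
        (box_sum c a x @ \oo --> f x).

Definition nash_on {n : nat} (U : set (Rn n)) (f : Rn n -> RR) : Prop :=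
  analytic_on U f /\
  exists2 P : {poly mpoly.mpoly n RR}, P != 0 &
    forall x, U x -> (map_poly (mpoly.meval (fun i => x ord0 i)) P).[f x] = 0.

Definition nash_S {n : nat} (U : set (Rn n)) (s : Rn n -> RR) : Prop :=
  nash_on U s /\ exists x, U x /\ s x != 0.

Definition partial {n : nat} (i : 'I_n) (f : Rn n -> RR) : Rn n -> RR :=
  fun x => 'D_('e_i : Rn n) f x.

Definition iter_partial {n : nat} (s : seq 'I_n) (f : Rn n -> RR) : Rn n -> RR :=
  foldr (fun i g => partial i g) f s.

Definition smooth_on {n : nat} (U : set (Rn n)) (f : Rn n -> RR) : Prop :=
  forall (s : seq 'I_n) x, U x ->
    {for x, continuous (iter_partial s f)} /\
    forall i : 'I_n, derivable (iter_partial s f) x ('e_i : Rn n).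

Record setoid_alg := SetoidAlg {
  sa_car  : Type;
  sa_mem  : sa_car -> Prop;
  sa_eqv  : sa_car -> sa_car -> Prop;
  sa_zero : sa_car;
  sa_one  : sa_car;
  sa_add  : sa_car -> sa_car -> sa_car;
  sa_opp  : sa_car -> sa_car;
  sa_mul  : sa_car -> sa_car -> sa_car;
  sa_scal : RR -> sa_car -> sa_car }.

Arguments sa_car s : clear implicits.
Arguments sa_mem s _  : clear implicits.
Arguments sa_eqv s _ _  : clear implicits.
Arguments sa_zero s  : clear implicits.
Arguments sa_one s  : clear implicits.
Arguments sa_add s _ _  : clear implicits.
Arguments sa_opp s _  : clear implicits.
Arguments sa_mul s _ _  : clear implicits.
Arguments sa_scal s _ _  : clear implicits.

(* Elements of the free A-module on the symbols dh (h in A): finite    *)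
(* formal sums  sum_k a_k dh_k, listed as pairs (a_k, h_k).            *)
Definition fsum (A : setoid_alg) := seq (sa_car A * sa_car A).

Definition fs_d {A : setoid_alg} (h : sa_car A) : fsum A := [:: (sa_one A, h)].
Definition fs_add {A : setoid_alg} (w1 w2 : fsum A) : fsum A := w1 ++ w2.
Definition fs_scale {A : setoid_alg} (b : sa_car A) (w : fsum A) : fsum A :=
  map (fun p => (sa_mul A b p.1, p.2)) w.
Definition fs_opp {A : setoid_alg} (w : fsum A) : fsum A := fs_scale (sa_opp A (sa_one A)) w.
Definition fs_sub {A : setoid_alg} (w1 w2 : fsum A) : fsum A := fs_add w1 (fs_opp w2).
Definition fs_sum {A : setoid_alg} (ws : seq (fsum A)) : fsum A := flatten ws.

(* total coefficient of the symbol dh0 (symbols dh, dh' coincide when h ~ h') *)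
Definition fs_coef {A : setoid_alg} (w : fsum A) (h0 : sa_car A) : sa_car A :=
  foldr (fun p acc => if `[< sa_eqv A p.2 h0 >] then sa_add A p.1 acc else acc)
        (sa_zero A) w.

Definition free_zero {A : setoid_alg} (w : fsum A) : Prop :=
  forall h0, sa_mem A h0 -> sa_eqv A (fs_coef w h0) (sa_zero A).

Inductive kgen (C : Type) : Type :=
| KAdd  of C & C
| KScal of RR & C
| KMul  of C & C.

Definition kgen_mem {A : setoid_alg} (g : kgen (sa_car A)) : Prop :=
  match g with
  | KAdd h k => sa_mem A h /\ sa_mem A k
  | KScal _ l => sa_mem A l
  | KMul p q => sa_mem A p /\ sa_mem A q
  end.

Definition kgen_elem {A : setoid_alg} (g : kgen (sa_car A)) : fsum A :=
  match g with
  | KAdd h k => fs_sub (fs_d (sa_add A h k)) (fs_add (fs_d h) (fs_d k))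
  | KScal lam l => fs_sub (fs_d (sa_scal A lam l)) (fs_scale (sa_scal A lam (sa_one A)) (fs_d l))
  | KMul p q => fs_sub (fs_d (sa_mul A p q)) (fs_add (fs_scale p (fs_d q)) (fs_scale q (fs_d p)))
  end.

Definition kahler_zero {A : setoid_alg} (w : fsum A) : Prop :=
  exists rs : seq (sa_car A * kgen (sa_car A)),
    (forall r, Stdlib.Lists.List.In r rs -> sa_mem A r.1 /\ kgen_mem r.2) /\
    free_zero (fs_sub w (fs_sum [seq fs_scale r.1 (kgen_elem r.2) | r <- rs])).

Definition kahler_eq {A : setoid_alg} (w1 w2 : fsum A) : Prop :=
  kahler_zero (fs_sub w1 w2).

Definition E_alg {n : nat} (U : set (Rn n)) : setoid_alg :=
  @SetoidAlg (Rn n -> RR) (smooth_on U)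
    (fun f g => forall x, U x -> f x = g x)
    (fun _ => 0) (fun _ => 1)
    (fun f g x => f x + g x) (fun f x => - f x)
    (fun f g x => f x * g x) (fun lam f x => lam * f x).

(* tilde E(U) = E(U)_S : fractions a/s with a in E(U), s in S.         *)
Definition Et_alg {n : nat} (U : set (Rn n)) : setoid_alg :=
  @SetoidAlg ((Rn n -> RR) * (Rn n -> RR))
    (fun p => smooth_on U p.1 /\ nash_S U p.2)
    (fun p q => exists t, nash_S U t /\
        forall x, U x -> t x * (p.1 x * q.2 x - q.1 x * p.2 x) = 0)
    (fun _ => 0, fun _ => 1) (fun _ => 1, fun _ => 1)
    (fun p q => (fun x => p.1 x * q.2 x + q.1 x * p.2 x, fun x => p.2 x * q.2 x))
    (fun p => (fun x => - p.1 x, p.2))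
    (fun p q => (fun x => p.1 x * q.1 x, fun x => p.2 x * q.2 x))
    (fun lam p => (fun x => lam * p.1 x, p.2)).

Definition to_Et {n : nat} (U : set (Rn n)) (a : Rn n -> RR) : sa_car (Et_alg U) :=
  (a, fun _ => 1).

End Defs.

Arguments sa_car {RR} s.
Arguments sa_mem {RR} s _.
Arguments sa_eqv {RR} s _ _.
Arguments sa_zero {RR} s.
Arguments sa_one {RR} s.
Arguments sa_add {RR} s _ _.
Arguments sa_opp {RR} s _.
Arguments sa_mul {RR} s _ _.
Arguments sa_scal {RR} s _ _.

(* Main.v *)
(** (1) => (2): take P of minimal degree with P(x, f) = 0 on U. The map
    omega h = dh - sum_i (d_i h) dx_i is a derivation of the smooth functions
    killing constants and coordinates, hence
    0 = omega (P(x, f)) = (dP/dy)(x, f) omega f, and g = (dP/dy)(x, f) is a Nash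
    function which is not identically zero by minimality. (2) => (3) inverts g
    and (3) => (4) is immediate.

    (4) => (1): suppose that f is not Nash, and choose an ultrafilter G
    containing all dense open subsets of U. By the identity theorem nonzero
    analytic functions on U are nonzero G-almost everywhere, so fractions of
    smooth functions by nonzero Nash functions take values in the ultrapower of
    R along G, a field of characteristic 0 in which x_1, ..., x_n, f are
    algebraically independent. The derivation with d x_i = 0 and d f = 1 extends
    to the finitely many elements occurring in a Kähler relation, where it
    contradicts df = sum_i f_i dx_i. The ultrapower is never formed: elements are
    real-valued functions, and identities are required to hold G-almost
    everywhere. *)

Require Import Defs.
From HB Require Import structures.
From mathcomp Require Import all_boot all_order all_algebra.
From mathcomp Require Import all_classical all_reals all_analysis.
From mathcomp Require Import lra ring.
From Stdlib Require Lists.List.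
From mathcomp Require mpoly.
Import (canonicals, coercions) mpoly.

Set Implicit Arguments.
Unset Strict Implicit.
Unset Printing Implicit Defensive.

Import Order.TTheory GRing.Theory Num.Theory.
Import numFieldNormedType.Exports.
Local Open Scope classical_set_scope.
Local Open Scope ring_scope.

(** * Locally convergent expansions *)

(** A formal sum is tested through functionals: its coefficients are evaluated at a point, each
    symbol is sent to a real number, and the products are added. Such a functional respects equality
    in the free module when the numbers depend only on the classes of the symbols, and it kills the
    relations that occur when it acts as a derivation on their finitely many arguments. This is why
    a derivation defined on finitely many adjoined values is enough. A single point cannot serve in
    the last implication: at a fixed x the reals x_1, ..., x_n, f(x) satisfy trivial polynomial
    equations over R. The ultrafilter replaces the point by a generic one, where only identities
    valid on a large set survive. Fractions raise another obstacle: their evaluation is meaningful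
    only off the zeros of the denominators, so such zeros are either multiplied away or discarded as
    negligible. Finally, sums over boxes of exponents behave badly under products and derivatives;
    analyticity is therefore restated with absolutely convergent series of finite blocks. *)

Section PowerSeries.
Context {R : realType} {n : nat}.
Local Notation Rn := 'rV[R]_n.
Local Notation expo := {ffun 'I_n -> nat}.
Definition psum (u : nat -> R) (N : nat) : R := \sum_(0 <= m < N) u m.

Implicit Types (a x z : Rn) (h : Rn -> R) (l : seq (R * expo)) (rho : R) (e : expo).

Definition mono e z : R := \prod_i z ord0 i ^+ e i.
Definition edeg e : nat := \sum_i e i.
Definition leval l z : R := \sum_(t <- l) t.1 * mono t.2 z.
(** The majorant of [leval] on the closed cube of radius [rho]. It is additive for concatenation and
    multiplicative for [lmul], so bounds for sums and products need no regrouping. *)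
Definition lnorm rho l : R := \sum_(t <- l) `|t.1| * rho ^+ edeg t.2.

Lemma ball_rV a r x : 0 < r ->
  ball a r x <-> forall i, `|x ord0 i - a ord0 i| < r.
Proof.
move=> r0; rewrite /ball /= /mx_ball; split=> [[_ H] i|H].
  by rewrite distrC; exact: H.
by split=> // i j; rewrite ord1 /ball /= distrC.
Qed.

Lemma mono_le e z rho : (forall i, `|z ord0 i| <= rho) -> `|mono e z| <= rho ^+ edeg e.
Proof.
move=> zr; rewrite /mono normr_prod expr_sum; apply: ler_prod => i _.
by rewrite normr_ge0 normrX lerXn2r ?nnegrE // (le_trans _ (zr i)).
Qed.

Lemma lnorm_ge0 rho l : 0 <= rho -> 0 <= lnorm rho l.
Proof. by move=> r0; apply: sumr_ge0 => t _; rewrite mulr_ge0 // exprn_ge0. Qed.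

Lemma le_lnorm r s l : 0 <= r -> r <= s -> lnorm r l <= lnorm s l.
Proof.
move=> r0 rs; apply: ler_sum => t _; apply: ler_wpM2l => //.
by rewrite lerXn2r // nnegrE (le_trans r0).
Qed.

Lemma leval_le l z rho : (forall i, `|z ord0 i| <= rho) -> `|leval l z| <= lnorm rho l.
Proof.
move=> zr; apply: le_trans (ler_norm_sum _ _ _) _; apply: ler_sum => t _.
by rewrite normrM ler_wpM2l // mono_le.
Qed.

(* The blocks [L m] are arbitrary finite lists of terms: exponents may repeat,
   so that sums, products and termwise derivatives of expansions are immediate. *)
Definition expands rho M (L : nat -> seq (R * expo)) a h :=
  (forall N, psum (fun m => lnorm rho (L m)) N <= M) /\
  (forall x, ball a rho x -> psum (fun m => leval (L m) (x - a)) @ \oo --> h x).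

Definition locexp a h :=
  exists rho M L, 0 < rho /\ expands rho M L a h.

Lemma subrV_ball a rho x : ball a rho x -> forall i, `|(x - a) ord0 i| <= rho.
Proof.
move=> [r0 H] i; rewrite !mxE; have := H ord0 i.
by rewrite /ball /= distrC => /ltW.
Qed.

Lemma expands_sub r rho M L a h : 0 < r -> r <= rho -> expands rho M L a h ->
  expands r M L a h.
Proof.
move=> r0 rr [H1 H2]; split=> [N|x xa].
  apply: le_trans (H1 N); rewrite /psum /=; apply: ler_sum => i _.
  by apply: le_lnorm => //; exact: ltW.
by apply: H2; apply: le_ball xa.
Qed.

Lemma locexp_const a (c : R) : locexp a (fun=> c).
Proof.
exists 1, `|c|, (fun m => if m is 0 then [:: (c, [ffun=> 0%N])] else [::]); split=> //.
have sE (u : nat -> R) N : (forall k, u k.+1 = 0) -> psum u N.+1 = u 0%N.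
  move=> u0; rewrite /psum /= big_nat_recl // big1 ?addr0 // => i _.
split=> [[|N]|x _]; first by rewrite /psum /= big_geq.
  rewrite sE => [|k]; last by rewrite /lnorm big_nil.
  by rewrite /lnorm big_seq1 /= expr1n mulr1.
rewrite -cvg_shiftS /=; apply: cvg_near_cst; apply: nearW => N.
rewrite sE => [|k]; last by rewrite /leval big_nil.
by rewrite /leval big_seq1 /= /mono big1 ?mulr1 // => i _; rewrite ffunE expr0.
Qed.

Lemma lnorm_cat rho l1 l2 : lnorm rho (l1 ++ l2) = lnorm rho l1 + lnorm rho l2.
Proof. exact: big_cat. Qed.

Lemma leval_cat l1 l2 z : leval (l1 ++ l2) z = leval l1 z + leval l2 z.
Proof. exact: big_cat. Qed.

Definition lmul l1 l2 : seq (R * expo) :=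
  [seq ((t : R * expo).1 * (s : R * expo).1, [ffun i => (t.2 i + s.2 i)%N]) | t <- l1, s <- l2].

Lemma leval_mul l1 l2 z : leval (lmul l1 l2) z = leval l1 z * leval l2 z.
Proof.
rewrite /leval big_distrlr /= big_allpairs_dep /=; apply: eq_bigr => t _.
apply: eq_bigr => s _; rewrite mulrACA; congr (_ * _).
by rewrite /mono -big_split /=; apply: eq_bigr => i _; rewrite ffunE exprD.
Qed.

Lemma lnorm_mul rho l1 l2 : lnorm rho (lmul l1 l2) = lnorm rho l1 * lnorm rho l2.
Proof.
rewrite /lnorm big_distrlr /= big_allpairs_dep /=; apply: eq_bigr => t _.
apply: eq_bigr => s _; rewrite mulrACA normrM; congr (_ * _).
rewrite -exprD; congr (_ ^+ _); rewrite /edeg -big_split /=.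
by apply: eq_bigr => i _; rewrite ffunE.
Qed.

Lemma locexp_common a h1 h2 : locexp a h1 -> locexp a h2 ->
  exists rho M1 M2 L1 L2, [/\ 0 < rho, expands rho M1 L1 a h1 & expands rho M2 L2 a h2].
Proof.
move=> [r1 [M1 [L1 [r10 E1]]]] [r2 [M2 [L2 [r20 E2]]]].
exists (Num.min r1 r2), M1, M2, L1, L2.
have r0 : 0 < Num.min r1 r2 by rewrite lt_min r10.
split=> //; [apply: expands_sub E1|apply: expands_sub E2] => //;
  by rewrite ge_min lexx ?orbT.
Qed.

Lemma locexpD a h1 h2 : locexp a h1 -> locexp a h2 -> locexp a (fun x => h1 x + h2 x).
Proof.
move=> E1 E2; have [rho [M1 [M2 [L1 [L2 [r0 [A1 B1] [A2 B2]]]]]]] := locexp_common E1 E2.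
exists rho, (M1 + M2), (fun m => L1 m ++ L2 m); split=> //; split=> [N|x xa].
  rewrite /psum; under eq_bigr do rewrite lnorm_cat.
  by rewrite big_split /=; apply: lerD; [exact: A1|exact: A2].
apply: cvg_trans (cvgD (B1 x xa) (B2 x xa)); apply: near_eq_cvg; apply: nearW => N.
by rewrite /psum; under [RHS]eq_bigr do rewrite leval_cat; rewrite big_split.
Qed.

Lemma leval_flatten N (L : nat -> seq (R * expo)) z :
  leval (flatten [seq L m | m <- iota 0 N]) z = psum (fun m => leval (L m) z) N.
Proof.
rewrite /psum /= /leval big_flatten /= big_map /index_iota subn0 //.
Qed.

Lemma lnorm_flatten N (L : nat -> seq (R * expo)) rho :
  lnorm rho (flatten [seq L m | m <- iota 0 N]) = psum (fun m => lnorm rho (L m)) N.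
Proof.
rewrite /psum /= /lnorm big_flatten /= big_map /index_iota subn0 //.
Qed.

Lemma locexpM a h1 h2 : locexp a h1 -> locexp a h2 -> locexp a (fun x => h1 x * h2 x).
Proof.
move=> E1 E2; have [rho [M1 [M2 [L1 [L2 [r0 [A1 B1] [A2 B2]]]]]]] := locexp_common E1 E2.
pose S (L : nat -> seq (R * expo)) N := flatten [seq L m | m <- iota 0 N].
(* p_m Q_{m+1} + P_m q_m telescopes to P_N Q_N *)
pose L m := lmul (L1 m) (S L2 m.+1) ++ lmul (S L1 m) (L2 m).
have tele (u v : nat -> R) N :
  \sum_(0 <= m < N) (u m * psum v m.+1 + psum u m * v m) = psum u N * psum v N.
  elim: N => [|N IH]; first by rewrite /psum /= !big_geq // mul0r.
  rewrite big_nat_recr //= IH /psum /= [in RHS]big_nat_recr //=.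
  rewrite !(big_nat_recr N) //=; ring.
exists rho, (M1 * M2), L; split=> //; split=> [N|x xa].
  rewrite /psum /=; under eq_bigr do rewrite lnorm_cat !lnorm_mul !lnorm_flatten.
  rewrite tele; apply: ler_pM; rewrite ?A1 ?A2 //;
  by apply: sumr_ge0 => i _; apply: lnorm_ge0; exact: ltW.
apply: cvg_trans (cvgM (B1 x xa) (B2 x xa)); apply: near_eq_cvg; apply: nearW => N.
rewrite /= -tele /psum /=; apply: eq_bigr => i _.
by rewrite leval_cat !leval_mul !leval_flatten.
Qed.

Lemma locexp_coord a (i : 'I_n) : locexp a (xcoord i).
Proof.
suff E : locexp a (fun x => (x - a) ord0 i).
  have := locexpD E (locexp_const a (a ord0 i)).
  by congr locexp; apply/funext => x; rewrite !mxE subrK.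
exists 1, 1, (fun m => if m is 0 then [:: (1, [ffun j => (j == i : nat)])] else [::]).
have sE (u : nat -> R) N : (forall k, u k.+1 = 0) -> psum u N.+1 = u 0%N.
  move=> u0; rewrite /psum /= big_nat_recl // big1 ?addr0 // => i _.
split=> //; split=> [[|N]|x _]; first by rewrite /psum /= big_geq.
  rewrite sE => [|k]; last by rewrite /lnorm big_nil.
  by rewrite /lnorm big_seq1 /= expr1n mulr1 normr1.
rewrite -cvg_shiftS /=; apply: cvg_near_cst; apply: nearW => N.
rewrite sE => [|k]; last by rewrite /leval big_nil.
rewrite /leval big_seq1 /= mul1r /mono (bigD1 i) //= ffunE eqxx expr1.
by rewrite big1 ?mulr1 // => j ji; rewrite ffunE (negbTE ji) expr0.
Qed.

End PowerSeries.

(** * Equivalence of box sums and block expansions *)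

Section BoxSums.
Context {R : realType} {n : nat}.
Local Notation Rn := 'rV[R]_n.
Local Notation expo := {ffun 'I_n -> nat}.
Implicit Types (a x z : Rn) (h : Rn -> R) (l : seq (R * expo)) (rho : R) (e : expo).

Lemma psum_cvg (u : nat -> R) B :
  (forall N, psum (fun m => `|u m|) N <= B) -> exists l : R, psum u @ \oo --> l.
Proof.
move=> uB; suff : cvgn (series u) by move=> /cvg_ex.
apply: normed_cvg; apply: nondecreasing_is_cvgn.
  apply/nondecreasing_seqP => N; have : psum (fun m => `|u m|) N <= psum (fun m => `|u m|) N.+1.
    by rewrite {2}/psum big_nat_recr //= lerDl.
  by [].
by exists B => _ [N _ <-]; exact: uB.
Qed.

Lemma psum_split (u : nat -> R) M N :
  psum u (M + N) = psum u M + psum (fun m => u (M + m)%N) N.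
Proof.
elim: N => [|N IH]; first by rewrite addn0 [X in _ = _ + X]/psum big_geq // addr0.
by rewrite addnS /psum !big_nat_recr //= -!/(psum _ _) IH addrA.
Qed.

Lemma psum_le_lim (u : nat -> R) (B : R) N : (forall m, 0 <= u m) ->
  psum u @ \oo --> B -> psum u N <= B.
Proof.
move=> u0 uB; apply: (cvgr_to_ge uB); exists N => // M /= /subnKC <-.
by rewrite psum_split lerDl sumr_ge0.
Qed.

Lemma cvg_lsum (I : Type) (r : seq I) (f : I -> nat -> R) (l : I -> R) :
  (forall i, f i @ \oo --> l i) ->
  (fun N => \sum_(i <- r) f i N) @ \oo --> \sum_(i <- r) l i.
Proof. by move=> fl; apply: cvg_big => //; exact: add_continuous. Qed.

Definition boxl N : seq expo :=
  [seq [ffun i => nat_of_ord (al i)] | al : {ffun 'I_n -> 'I_N.+1}].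

Lemma boxl_uniq N : uniq (boxl N).
Proof.
rewrite map_inj_uniq ?enum_uniq // => u v /ffunP H; apply/ffunP => i.
by apply: val_inj; have := H i; rewrite !ffunE.
Qed.

Lemma mem_boxl N e : (e \in boxl N) = [forall i, (e i <= N)%N].
Proof.
apply/idP/forallP => [/mapP[al _ ->] i|H]; first by rewrite ffunE -ltnS.
apply/mapP; exists [ffun i => inord (e i)]; first by rewrite mem_enum.
by apply/ffunP => i; rewrite !ffunE inordK // ltnS.
Qed.

Lemma big_boxl N (G : ('I_n -> nat) -> R) :
  \sum_(al : {ffun 'I_n -> 'I_N.+1}) G (fun i => nat_of_ord (al i)) =
  \sum_(e <- boxl N) G e.
Proof.
rewrite big_map big_enum /=; apply: eq_bigr => al _; congr G.
by apply/funext => i; rewrite ffunE.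
Qed.

(** The exponents that enter at box [N]. Cutting the boxes into these differences turns a box sum
    into a partial sum of blocks, with the shift [N.+1] because [psum] excludes its upper index. *)
Definition shell N : seq expo :=
  if N is k.+1 then [seq e <- boxl N | e \notin boxl k] else boxl 0.

Lemma psum_shell N (G : expo -> R) :
  psum (fun m => \sum_(e <- shell m) G e) N.+1 = \sum_(e <- boxl N) G e.
Proof.
elim: N => [|N IH]; first by rewrite /psum big_nat1.
rewrite /psum big_nat_recr //= -/(psum _ _) IH -big_cat /=; apply: perm_big.
apply: uniq_perm; rewrite ?boxl_uniq //.
  rewrite cat_uniq boxl_uniq filter_uniq ?boxl_uniq // andbT /=.
  by apply/hasPn => e; rewrite mem_filter => /andP[].
move=> e; rewrite mem_cat mem_filter; case: (boolP (e \in boxl N)) => //=.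
by rewrite !mem_boxl => /forallP H; apply/esym/forallP => i; rewrite ltnW // ltnS.
Qed.

(** One point controls a whole cube: at the corner [a + const_mx (r / 2)] each monomial has absolute
    value [(r / 2) ^+ edeg e], so the absolute bound there is exactly a bound of the majorant.
    Halving [r] puts this corner inside the ball. *)
Lemma analytic_locexp U h a : analytic_on U h -> U a -> locexp a h.
Proof.
move=> /[apply] -[c [r r0 H]].
have r20 : 0 < r / 2 by rewrite divr_gt0.
have r2r : r / 2 < r by rewrite ltr_pdivrMr // ltr_pMr // ltr1n.
have [] := H (a + const_mx (r / 2)).
  by apply/ball_rV => // i; rewrite !mxE addrAC subrr add0r ger0_norm // ltW.
move=> [M HM] _.
exists (r / 2), M, (fun m => [seq (c (e : expo), e) | e <- shell m]); split => //; split.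
  have E N : psum (fun m => lnorm (r / 2) [seq (c (e : expo), e) | e <- shell m]) N.+1 <= M.
    rewrite (_ : psum _ _ = psum (fun m => \sum_(e <- shell m) `|c e| * (r / 2) ^+ edeg e) N.+1).
      apply: le_trans (HM N).
      rewrite psum_shell /box_abs_sum (big_boxl N (fun g => `|c g| * `|monomial a _ g|)).
      apply: ler_sum => e _; rewrite ler_wpM2l // /monomial normr_prod expr_sum.
      apply: ler_prod => i _; rewrite exprn_ge0 ?(ltW r20) //= normrX.
      by rewrite lerXn2r ?nnegrE ?(ltW r20) // !mxE addrAC subrr add0r ger0_norm // ltW.
    by rewrite /psum; apply: eq_bigr => m _; rewrite /lnorm big_map.
  case=> [|N]; last exact: E.
  rewrite /psum big_geq //; apply: le_trans (HM 0%N).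
  by apply: sumr_ge0 => i _; rewrite mulr_ge0.
move=> x xa; have [_] := H x (le_ball (ltW r2r) xa).
rewrite -[X in _ -> X]cvg_shiftS; apply: cvg_trans; apply: near_eq_cvg; apply: nearW => N /=.
rewrite (_ : psum _ _ = psum (fun m => \sum_(e <- shell m) c e * mono e (x - a)) N.+1).
  rewrite psum_shell /box_sum (big_boxl N (fun g => c g * monomial a x g)).
  apply: eq_bigr => e _; congr (_ * _); apply: eq_bigr => i _; by rewrite !mxE.
by rewrite /psum; apply: eq_bigr => m _; rewrite /leval big_map.
Qed.

Definition coefl e l : R := \sum_(t <- l | t.2 == e) t.1.

Lemma sum_coefl (s : seq expo) l (G : expo -> R) : uniq s ->
  \sum_(e <- s) coefl e l * G e = \sum_(t <- l | t.2 \in s) t.1 * G t.2.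
Proof.
move=> us; elim: l => [|t l IH].
  by rewrite big_nil big1 // => e _; rewrite /coefl big_nil mul0r.
rewrite big_cons -IH.
have E e : coefl e (t :: l) * G e = (if e == t.2 then t.1 * G t.2 else 0) + coefl e l * G e.
  rewrite /coefl big_cons eq_sym; case: eqP => [->|_]; first by rewrite mulrDl.
  by rewrite add0r.
under eq_bigr do rewrite E.
rewrite big_split /= -big_mkcond /=; case: (boolP (t.2 \in s)) => ts.
  by rewrite -big_filter filter_pred1_uniq // big_seq1.
by rewrite big1_seq ?add0r // => e /andP[/eqP-> es]; rewrite es in ts.
Qed.

Lemma norm_coefl e l : `|coefl e l| <= coefl e [seq (`|t.1|, t.2) | t <- l].
Proof. by rewrite /coefl big_map; exact: ler_norm_sum. Qed.

(** Absolute convergence permits regrouping: the coefficient of [e] collects the occurrences of [e]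
    in all blocks, and the box sums of these coefficients have the same limit as the block sums. *)
Lemma locexp_analytic U h : (forall a, U a -> locexp a h) -> analytic_on U h.
Proof.
move=> H a /H [rho [M [L [r0 [HM HL]]]]].
have nL N e : psum (fun m => `|coefl e (L m)|) N * rho ^+ edeg e <= M.
  apply: le_trans (HM N); rewrite /psum mulr_suml; apply: ler_sum => m _.
  rewrite (le_trans (ler_wpM2r (exprn_ge0 _ (ltW r0)) (norm_coefl _ _))) //.
  rewrite /coefl big_map /= mulr_suml /lnorm big_mkcond; apply: ler_sum => t _.
  by case: eqP => [->//|_]; rewrite mulr_ge0 // exprn_ge0 // ltW.
have /choice[c Hc] e : exists c : R, psum (fun m => coefl e (L m)) @ \oo --> c.
  apply: (@psum_cvg _ (M / rho ^+ edeg e)) => N.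
  by rewrite ler_pdivlMr ?exprn_gt0.
exists (fun g => c [ffun i => g i]), rho => // x xa.
set z := x - a.
have zr i : `|z ord0 i| <= rho by exact: subrV_ball.
have cE N (G : expo -> R) : \sum_(e <- boxl N) c [ffun i => e i] * G e =
    \sum_(e <- boxl N) c e * G e.
  by apply: eq_bigr => e _; congr (c _ * _); apply/ffunP => i; rewrite ffunE.
have monoE e : monomial a x e = mono e z.
  by apply: eq_bigr => i _; rewrite !mxE.
have partE N K : \sum_(e <- boxl N) psum (fun m => coefl e (L m)) K * mono e z =
    psum (fun m => \sum_(t <- L m | t.2 \in boxl N) t.1 * mono t.2 z) K.
  rewrite /psum; under eq_bigr do rewrite mulr_suml.
  rewrite exchange_big /=; apply: eq_bigr => m _.
  exact/sum_coefl/boxl_uniq.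
split.
  exists M => N; rewrite /box_abs_sum.
  rewrite (big_boxl N (fun g => `|c [ffun i => g i]| * `|monomial a x g|)).
  have -> : \sum_(e <- boxl N) `|c [ffun i => e i]| * `|monomial a x e| =
            \sum_(e <- boxl N) `|c e| * `|mono e z|.
    apply: eq_bigr => e _; rewrite monoE; congr (`|c _| * _).
    by apply/ffunP => i; rewrite ffunE.
  have lim_c : (fun K => \sum_(e <- boxl N) `|psum (fun m => coefl e (L m)) K| * `|mono e z|)
      @ \oo --> \sum_(e <- boxl N) `|c e| * `|mono e z|.
    by apply: cvg_lsum => e; apply: cvgMl; apply: cvg_norm; exact: Hc.
  apply: (cvgr_to_le lim_c); apply: nearW => K; apply: le_trans (HM K).
  apply: (@le_trans _ _ (\sum_(e <- boxl N)
     psum (fun m => coefl e [seq (`|t.1|, t.2) | t <- L m]) K * rho ^+ edeg e)).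
    apply: ler_sum => e _; apply: ler_pM => //; last exact: mono_le.
    apply: le_trans (ler_norm_sum _ _ _) _; apply: ler_sum => m _.
    exact: norm_coefl.
  rewrite /psum; under eq_bigr do rewrite mulr_suml.
  rewrite exchange_big /=; apply: ler_sum => m _.
  rewrite sum_coefl ?boxl_uniq // big_map /lnorm big_mkcond /=.
  apply: ler_sum => t _; case: ifP => // _.
  by rewrite mulr_ge0 // exprn_ge0 // ltW.
(* [T N m] is the majorant of the terms of block [m] outside box [N]; it bounds the error of the box
   sum. For large [N] it vanishes on the first [K0] blocks, and on the others it is dominated by the
   tail of a convergent series. *)
pose T N m := \sum_(t <- L m | t.2 \notin boxl N) `|t.1| * rho ^+ edeg t.2.
have box_lim N : (fun K => psum (fun m => leval (L m) z) K -
      psum (fun m => \sum_(t <- L m | t.2 \in boxl N) t.1 * mono t.2 z) K)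
    @ \oo --> h x - box_sum (fun g => c [ffun i => g i]) a x N.
  apply: cvgB; first exact: HL.
  under [X in X @ _]funext do rewrite -partE.
  rewrite /box_sum (big_boxl N (fun g => c [ffun i => g i] * monomial a x g)).
  have -> : \sum_(e <- boxl N) c [ffun i => e i] * monomial a x e =
            \sum_(e <- boxl N) c e * mono e z.
    by rewrite cE; apply: eq_bigr => e _; rewrite monoE.
  by apply: cvg_lsum => e; apply: cvgMl; exact: Hc.
have box_err N B : (forall K, psum (T N) K <= B) ->
    `|h x - box_sum (fun g => c [ffun i => g i]) a x N| <= B.
  move=> HB; apply: (cvgr_to_le (cvg_norm (box_lim N))); apply: nearW => K.
  apply: le_trans (HB K); rewrite /psum -sumrB.
  apply: le_trans (ler_norm_sum _ _ _) _; apply: ler_sum => m _.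
  rewrite /leval (bigID (fun t => t.2 \in boxl N)) /= addrAC subrr add0r.
  apply: le_trans (ler_norm_sum _ _ _) _; apply: ler_sum => t _.
  by rewrite normrM ler_wpM2l // mono_le.
have T0 N m : 0 <= T N m.
  by apply: sumr_ge0 => t _; rewrite mulr_ge0 // exprn_ge0 // ltW.
have TL N m : T N m <= lnorm rho (L m).
  rewrite /T /lnorm big_mkcond /=; apply: ler_sum => t _.
  by case: ifP => // _; rewrite mulr_ge0 // exprn_ge0 // ltW.
have L0 m : 0 <= lnorm rho (L m) by rewrite lnorm_ge0 // ltW.
have [B HB] : exists B : R, psum (fun m => lnorm rho (L m)) @ \oo --> B.
  apply: (@psum_cvg _ M) => N; apply: le_trans (HM N).
  by rewrite /psum; apply: ler_sum => m _; rewrite ger0_norm.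
have psumB K := psum_le_lim K L0 HB.
have ltbox e : exists N0, forall N, (N0 <= N)%N -> e \in boxl N.
  exists (edeg e) => N eN; rewrite mem_boxl; apply/forallP => i.
  by apply: leq_trans eN; rewrite /edeg (bigD1 i) //= leq_addr.
have boxT K0 : exists N0, forall N, (N0 <= N)%N -> forall m, (m < K0)%N -> T N m = 0.
  have boxl1 l : exists N0, forall N, (N0 <= N)%N -> forall t, t \in l -> t.2 \in boxl N.
    elim: l => [|t l [N0 H0]]; first by exists 0%N.
    have [N1 H1] := ltbox t.2; exists (maxn N0 N1) => N.
    rewrite geq_max => /andP[N0N N1N] u; rewrite inE => /orP[/eqP->|]; first exact: H1.
    exact: H0.
  elim: K0 => [|K0 [N0 H0]]; first by exists 0%N.
  have [N1 H1] := boxl1 (L K0); exists (maxn N0 N1) => N.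
  rewrite geq_max => /andP[N0N N1N] m; rewrite ltnS leq_eqVlt => /orP[/eqP->|]; last exact: H0.
  by rewrite /T big1_seq // => t /andP[/negP tN tl]; case: tN; exact: H1 tl.
apply/cvgrPdist_le => eps eps0.
have [K0 _ /(_ K0 (leqnn _)) HK0] := (cvgrPdist_le _ _).1 HB _ eps0.
have [N0 HN0] := boxT K0.
exists N0 => // N /= N0N; apply: box_err => K.
apply: (@le_trans _ _ (psum (T N) (K0 + K))).
  by rewrite addnC psum_split lerDl sumr_ge0.
rewrite psum_split {1}/psum big1_seq ?add0r; last first.
  by move=> m; rewrite mem_index_iota => /andP[_ mK0]; apply: HN0.
apply: (@le_trans _ _ (psum (fun m => lnorm rho (L (K0 + m)%N)) K)).
  by apply: ler_sum => m _; exact: TL.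
rewrite -(lerD2l (psum (fun m => lnorm rho (L m)) K0)) -psum_split.
apply: le_trans (psumB _) _; rewrite -lerBlDl; apply: le_trans HK0.
exact: ler_norm.
Qed.

Lemma analyticE U h : analytic_on U h <-> forall a, U a -> locexp a h.
Proof.
by split; [move=> hU a Ua; exact: analytic_locexp Ua|exact: locexp_analytic].
Qed.

End BoxSums.

(** * Termwise differentiation and continuity of expansions *)

Section Differentiation.
Context {R : realType} {n : nat}.
Local Notation Rn := 'rV[R]_n.
Local Notation expo := {ffun 'I_n -> nat}.
Implicit Types (a x z : Rn) (h : Rn -> R) (l : seq (R * expo)) (rho : R) (e : expo).

(** Induction on [k]: the error at [k.+1] is [u + s] times the error at [k] plus
    [s ^+ 2 * (k%:R * u ^+ k.-1)], and k^2 + k <= (k + 1)^2. The factor [r ^+ 2] is kept on the left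
    to avoid dividing by [r], which may be 0. *)
Lemma expr_taylor2 (r u s : R) k : `|u| <= r -> `|u + s| <= r ->
  `|(u + s) ^+ k - u ^+ k - s * (k%:R * u ^+ k.-1)| * r ^+ 2 <=
  s ^+ 2 * (k%:R ^+ 2 * r ^+ k).
Proof.
move=> ur usr; have r0 : 0 <= r by apply: le_trans ur.
elim: k => [|k IH].
  by rewrite !expr0 mul0r mulr0 subr0 subrr normr0 mul0r expr0n mul0r mulr0.
set E := (u + s) ^+ k - _ - _ in IH.
have -> : (u + s) ^+ k.+1 - u ^+ k.+1 - s * (k.+1%:R * u ^+ k.+1.-1) =
    (u + s) * E + s ^+ 2 * (k%:R * u ^+ k.-1).
  rewrite /E -[k.+1]addn1 natrD !exprD !expr1 /= addn1 /=.
  case: (k) => [|m] /=; first by rewrite !expr0; ring.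
  by rewrite !exprS -[m.+1]addn1 natrD /=; ring.
have H1 : `|(u + s) * E| * r ^+ 2 <= s ^+ 2 * (k%:R ^+ 2 * r ^+ k.+1).
  rewrite normrM -mulrA; apply: le_trans (ler_pM _ _ usr IH) _ => //.
    by rewrite mulr_ge0 // exprn_ge0.
  by rewrite (exprS r k) mulrCA [r * (_ * _)]mulrCA.
have H2 : `|s ^+ 2 * (k%:R * u ^+ k.-1)| * r ^+ 2 <= s ^+ 2 * (k%:R * r ^+ k.+1).
  case: k {IH E H1} => [|k]; first by rewrite !mul0r !mulr0 normr0 mul0r.
  rewrite normrM normrX real_normK ?num_real // -mulrA ler_wpM2l ?sqr_ge0 //.
  rewrite normrM normr_nat -mulrA ler_wpM2l // normrX /= -[k.+2]addn2 exprD.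
  by rewrite ler_wpM2r ?exprn_ge0 // lerXn2r ?nnegrE.
rewrite (le_trans (ler_wpM2r (sqr_ge0 _) (ler_normD _ _))) // mulrDl.
apply: le_trans (lerD H1 H2) _; rewrite -mulrDr ler_wpM2l ?sqr_ge0 //.
rewrite -mulrDl ler_wpM2r ?exprn_ge0 // -[k.+1]addn1 natrD /=.
by have := ler0n R k; nra.
Qed.

(** For a zero exponent the factor [(t.2 i)%:R] vanishes, so the truncated predecessor does no
    harm. *)
Definition dterm (i : 'I_n) (t : R * expo) : R * expo :=
  (t.1 * (t.2 i)%:R, [ffun j => if j == i then (t.2 j).-1 else t.2 j]).

Definition dl (i : 'I_n) l := [seq dterm i t | t <- l].

Lemma natr_le_exp2 k : k%:R <= 2 ^+ k :> R.
Proof. by rewrite -natrX ler_nat ltnW // ltn_expl. Qed.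

Lemma edegE i e : edeg e = (e i + \sum_(j | j != i) e j)%N.
Proof. by rewrite /edeg (bigD1 i). Qed.

(** A Cauchy estimate: the factor [e i] created by differentiation is absorbed by k <= 2^k, that is,
    by doubling the radius. *)
Lemma lnorm_dl (r : R) i l : 0 <= r -> lnorm r (dl i l) * r <= lnorm (2 * r) l.
Proof.
move=> r0; rewrite /lnorm big_map mulr_suml; apply: ler_sum => -[c e] _ /=.
rewrite normrM normr_nat -!mulrA ler_wpM2l // -exprSr !(edegE i) ffunE eqxx.
rewrite (eq_bigr e) => [|j ji]; last by rewrite ffunE (negbTE ji).
set d := (\sum_(_ < _ | _) _)%N.
case: (e i) => [|k] /=; first by rewrite mul0r exprn_ge0 // mulr_ge0.
rewrite -addSn exprMn ler_wpM2r ?exprn_ge0 //.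
by rewrite exprD (le_trans (natr_le_exp2 _)) // ler_peMr ?exprn_ge0 // exprn_ege1 // ler1n.
Qed.

Lemma mono_shift i e z s :
  mono e (z + s *: 'e_i) = (z ord0 i + s) ^+ e i * \prod_(j | j != i) z ord0 j ^+ e j.
Proof.
rewrite /mono (bigD1 i) //= !mxE !eqxx mulr1; congr (_ * _).
by apply: eq_bigr => j ji; rewrite !mxE (negbTE ji) andbF mulr0 addr0.
Qed.

(** The factor k^2 of [expr_taylor2] is absorbed by k^2 <= 4^k; this is the origin of the radius
    [4 * r], and of [rho / 4] in what follows. *)
Lemma leval_taylor2 (r s : R) i l z : (forall j, `|z ord0 j| <= r) -> `|z ord0 i + s| <= r ->
  `|leval l (z + s *: 'e_i) - leval l z - s * leval (dl i l) z| * r ^+ 2 <=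
  s ^+ 2 * lnorm (4 * r) l.
Proof.
move=> zr zsr; have r0 : 0 <= r by apply: le_trans (zr i).
rewrite /leval big_map mulr_sumr -!sumrB /lnorm mulr_sumr.
rewrite (le_trans (ler_wpM2r (sqr_ge0 _) (ler_norm_sum _ _ _))) // mulr_suml.
apply: ler_sum => -[c e] _ /=; rewrite mono_shift.
have -> : mono e z = z ord0 i ^+ e i * \prod_(j | j != i) z ord0 j ^+ e j.
  by rewrite /mono (bigD1 i).
have -> : mono [ffun j => if j == i then (e j).-1 else e j] z =
    z ord0 i ^+ (e i).-1 * \prod_(j | j != i) z ord0 j ^+ e j.
  rewrite /mono (bigD1 i) //= ffunE eqxx; congr (_ * _).
  by apply: eq_bigr => j ji; rewrite ffunE (negbTE ji).
set Q := \prod_(_ < _ | _) _.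
have QE : `|Q| <= r ^+ (\sum_(j | j != i) e j).
  rewrite /Q normr_prod expr_sum; apply: ler_prod => j _.
  by rewrite normr_ge0 normrX lerXn2r ?nnegrE.
have H := expr_taylor2 (e i) (zr i) zsr.
set u := z ord0 i in H *; set k := e i in H *.
have -> : c * ((u + s) ^+ k * Q) - c * (u ^+ k * Q) - s * (c * k%:R * (u ^+ k.-1 * Q)) =
  c * ((u + s) ^+ k - u ^+ k - s * (k%:R * u ^+ k.-1)) * Q by ring.
rewrite !normrM; set X := `|_ - _ - _| in H *.
have -> : `|c| * X * `|Q| * r ^+ 2 = `|c| * (X * r ^+ 2 * `|Q|) by ring.
rewrite [leRHS]mulrCA ler_wpM2l //.
apply: le_trans (ler_pM _ _ H QE) _ => //; first by rewrite /X mulr_ge0 ?exprn_ge0.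
rewrite -mulrA ler_wpM2l ?sqr_ge0 // -mulrA -exprD (edegE i) -/k exprMn.
rewrite ler_wpM2r ?exprn_ge0 //.
apply: le_trans (_ : 4 ^+ k <= _); last by rewrite ler_eXn2l ?leq_addr // ltr1n.
rewrite (_ : 4 = 2 ^+ 2 :> R); last by rewrite -natrX.
by rewrite -exprM mulnC exprM lerXn2r ?nnegrE ?exprn_ge0 // natr_le_exp2.
Qed.

(** A quadratic error bound with a uniform constant survives the limit of the partial sums, so this
    criterion replaces an interchange of limit and derivative. *)
Lemma quad_derive (V : normedModType R) (h : V -> R) (x v : V) (G K d : R) : 0 < d ->
  (forall s, `|s| < d -> `|h (x + s *: v) - h x - s * G| <= K * s ^+ 2) ->
  derivable h x v /\ 'D_v h x = G.
Proof.
move=> d0 H.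
have C : (fun s => s^-1 *: ((h \o shift x) (s *: v) - h x)) @ 0^' --> G.
  apply/cvgrPdist_le => eps eps0.
  have e0 : 0 < Num.min (d / 2) (eps / (`|K| + 1)).
    by rewrite lt_min !divr_gt0 // ltr_wpDl.
  near=> s.
  have s0 : s != 0 by near: s; exact: nbhs_dnbhs_neq.
  have : `|s| <= Num.min (d / 2) (eps / (`|K| + 1)) by near: s; exact: dnbhs0_le.
  rewrite le_min => /andP[sd se].
  have sd' : `|s| < d by apply: le_lt_trans sd _; rewrite ltr_pdivrMr // ltr_pMr // ltr1n.
  have := H s sd'; rewrite /= [s *: v + x]addrC => Hs.
  have -> : G - s^-1 *: (h (x + s *: v) - h x) = - (s^-1 * (h (x + s *: v) - h x - s * G)).
    by rewrite /GRing.scale /= !mulrBr mulKf //; ring.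
  rewrite normrN normrM normfV mulrC ler_pdivrMr ?normr_gt0 //.
  apply: le_trans Hs _; apply: (@le_trans _ _ (`|K| * (`|s| * `|s|))).
    by rewrite -normrM -expr2 [X in _ <= _ * X]ger0_norm ?sqr_ge0 // ler_wpM2r ?sqr_ge0 // ler_norm.
  rewrite mulrA ler_wpM2r //; move: se; rewrite ler_pdivlMr ?ltr_wpDl //.
  by have := normr_ge0 s; have := normr_ge0 K; nra.
split; first by apply/cvg_ex; exists G.
exact/cvg_lim.
Unshelve. all: by end_near.
Qed.

Lemma expands_derive rho M L a h i x : 0 < rho -> expands rho M L a h ->
  ball a (rho / 4) x ->
  derivable h x ('e_i : Rn) /\
  psum (fun m => leval (dl i (L m)) (x - a)) @ \oo --> partial i h x.
Proof.
move=> rho0 [HM HL] xa; set r := rho / 4.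
have r0 : 0 < r by rewrite divr_gt0.
have r4 : 4 * r = rho by rewrite /r mulrC divfK.
have dlM N : psum (fun m => lnorm r (dl i (L m))) N <= M / r.
  rewrite ler_pdivlMr //; apply: le_trans (HM N); rewrite /psum mulr_suml.
  apply: ler_sum => m _; apply: le_trans (lnorm_dl _ _ (ltW r0)) _.
  by apply: le_lnorm; have := r0; have := r4; lra.
have xr := subrV_ball xa.
have [G HG] : exists G : R, psum (fun m => leval (dl i (L m)) (x - a)) @ \oo --> G.
  apply: (@psum_cvg R _ (M / r)) => N; apply: le_trans (dlM N).
  by rewrite /psum; apply: ler_sum => m _; exact: leval_le.
(* For [s] below [d] in absolute value the shifted point stays in the cube of radius [r] around [a],
   where the Taylor bound of every block applies. *)
pose d := r - `|(x - a) ord0 i|.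
have d0 : 0 < d by rewrite subr_gt0; move/(ball_rV _ _ r0): xa => /(_ i); rewrite !mxE.
suff H (s : R) : `|s| < d -> `|h (x + s *: 'e_i) - h x - s * G| <= (M / r ^+ 2) * s ^+ 2.
  by have [D1 D2] := quad_derive d0 H; split => //; rewrite /partial D2.
move=> sd; have usr : `|(x - a) ord0 i + s| <= r.
  apply: le_trans (ler_normD _ _) _; rewrite -lerBrDl; exact: ltW.
have rrho : r <= rho by rewrite -r4 ler_peMl ?(ltW r0) // ler1n.
have xarho : ball a rho x by exact: le_ball xa.
have xsrho : ball a rho (x + s *: 'e_i).
  apply/(ball_rV _ _ rho0) => j; rewrite !mxE eqxx /=.
  case: (eqVneq j i) => [->|ji]; last first.
    by rewrite mulr0 addr0; move/(ball_rV _ _ rho0): xarho.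
  move: usr; rewrite !mxE mulr1 addrAC => /le_lt_trans; apply.
  by rewrite -r4 ltr_pMl // ltr1n.
have lim : (fun N => psum (fun m => leval (L m) (x + s *: 'e_i - a)) N -
    psum (fun m => leval (L m) (x - a)) N - s * psum (fun m => leval (dl i (L m)) (x - a)) N)
    @ \oo --> h (x + s *: 'e_i) - h x - s * G.
  apply: cvgB; first by apply: cvgB; exact: HL.
  by apply: cvgM HG; exact: cvg_cst.
rewrite mulrAC ler_pdivlMr ?exprn_gt0 //.
have lim2 := cvgM (cvg_norm lim) (@cvg_cst R (r ^+ 2) nat _ eventually_filter).
apply: (cvgr_to_le (lim2 _ _)); apply: nearW => N /=.
rewrite [leRHS]mulrC; apply: le_trans (_ : s ^+ 2 * psum (fun m => lnorm rho (L m)) N <= _); last first.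
  by rewrite ler_wpM2l ?sqr_ge0.
rewrite /psum [s * _]mulr_sumr -!sumrB mulr_sumr.
rewrite (le_trans (ler_wpM2r (sqr_ge0 _) (ler_norm_sum _ _ _))) // mulr_suml.
apply: ler_sum => m _; rewrite -[x + _ - a]addrAC -r4.
by apply: leval_taylor2.
Qed.

Lemma locexp_partial i a h : locexp a h -> locexp a (partial i h).
Proof.
move=> [rho [M [L [rho0 E]]]]; have r0 : 0 < rho / 4 by rewrite divr_gt0.
exists (rho / 4), (M / (rho / 4)), (fun m => dl i (L m)); split=> //; split=> [N|x xa].
  rewrite ler_pdivlMr //; apply: le_trans (E.1 N); rewrite /psum mulr_suml.
  apply: ler_sum => m _; apply: le_trans (lnorm_dl _ _ (ltW r0)) _.
  by apply: le_lnorm; lra.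
by have [] := expands_derive i rho0 E xa.
Qed.

Lemma locexp_derivable i a h : locexp a h -> derivable h a ('e_i : Rn).
Proof.
move=> [rho [M [L [rho0 E]]]].
have [|//] := expands_derive (x := a) i rho0 E.
by apply: ballxx; rewrite divr_gt0.
Qed.

Lemma leval_continuous l a : continuous (fun x => leval l (x - a)).
Proof.
move=> x; pose B := @cvg_big R.
apply: (B _ _ _ predT _ _ (nbhs x)) => [|t _]; first exact: add_continuous.
apply: (@cvgM _ _ (nbhs x)); first exact: cvg_cst.
apply: (B _ _ _ predT _ _ (nbhs x)) => [|j _]; first exact: mul_continuous.
apply: (@continuous_comp _ _ _ (fun x : Rn => (x - a) ord0 j) (fun u => u ^+ t.2 j)).
  have -> : (fun x : Rn => (x - a) ord0 j) = (fun x => x ord0 j - a ord0 j).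
    by apply/funext => y; rewrite !mxE.
  by apply: (@cvgB _ _ _ (nbhs x)); [exact: coord_continuous|exact: cvg_cst].
exact: exprn_continuous.
Qed.

Lemma locexp_continuous a h : locexp a h -> {for a, continuous h}.
Proof.
move=> [rho [M [L [rho0 [HM HL]]]]].
have L0 m : 0 <= lnorm rho (L m) by rewrite lnorm_ge0 // ltW.
have [B HB] : exists B : R, psum (fun m => lnorm rho (L m)) @ \oo --> B.
  apply: (@psum_cvg R _ M) => N; apply: le_trans (HM N).
  by rewrite /psum; apply: ler_sum => m _; rewrite ger0_norm.
have psumB K := psum_le_lim K L0 HB.
have tail K x : ball a rho x ->
    `|h x - psum (fun m => leval (L m) (x - a)) K| <= B - psum (fun m => lnorm rho (L m)) K.
  move=> xa; have lim : (fun K' => psum (fun m => leval (L m) (x - a)) K' -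
      psum (fun m => leval (L m) (x - a)) K) @ \oo --> h x - psum (fun m => leval (L m) (x - a)) K.
    by apply: cvgB (HL x xa) _; exact: cvg_cst.
  apply: (cvgr_to_le (cvg_norm lim)); exists K => // K' /= /subnKC <- /=.
  rewrite psum_split [X in `|X|]addrAC subrr add0r.
  apply: le_trans (_ : psum (fun m => lnorm rho (L (K + m)%N)) (K' - K) <= _).
    apply: le_trans (ler_norm_sum _ _ _) _; apply: ler_sum => m _.
    by apply: leval_le; exact: subrV_ball.
  by rewrite lerBrDl -psum_split.
apply/(@cvgrPdist_le _ _ _ (nbhs a)) => eps eps0.
have [K _ /(_ K (leqnn _)) HK] := (cvgrPdist_le _ _).1 HB _ (divr_gt0 eps0 (ltr0n _ 3)).
have e30 : 0 < eps / 3 by rewrite divr_gt0.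
have C : continuous (fun x => psum (fun m => leval (L m) (x - a)) K).
  move=> x; apply: (@cvg_big R _ _ _ predT _ _ (nbhs x)) => [|m _]; first exact: add_continuous.
  exact: leval_continuous.
have := (@cvgrPdist_le _ _ _ (nbhs a) _ _ _).1 (C a) _ e30 => Ca.
near=> x.
have xa : ball a rho x by near: x; exact: nbhsx_ballx.
have T1 := tail K x xa; have T2 := tail K a (ballxx _ rho0).
have T3 : `|psum (fun m => leval (L m) (a - a)) K - psum (fun m => leval (L m) (x - a)) K| <= eps / 3.
  by near: x; exact: Ca.
have HK' := le_trans (ler_norm _) HK.
rewrite (_ : h a - h x = (h a - psum (fun m => leval (L m) (a - a)) K) +
  (psum (fun m => leval (L m) (a - a)) K - psum (fun m => leval (L m) (x - a)) K)
  - (h x - psum (fun m => leval (L m) (x - a)) K)); last by ring.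
apply: le_trans (ler_normB _ _) _.
apply: le_trans (lerD (ler_normD _ _) (lexx _)) _.
move: T1 T2 T3 HK'; set X := `|_|; set Y := `|_|; set Z := `|_|; lra.
Unshelve. all: by end_near.
Qed.

End Differentiation.

(** * Smooth and analytic functions *)

Section Smooth.
Context {R : realType} {n : nat}.
Local Notation Rn := 'rV[R]_n.
Implicit Types (U : set Rn) (a x : Rn) (f g h : Rn -> R).

Lemma near_open U f g x : open U -> (forall y, U y -> f y = g y) -> U x ->
  {near x, f =1 g}.
Proof. by move=> oU fg Ux; near=> y; apply: fg; near: y; exact: open_nbhs_nbhs.
Unshelve. all: by end_near. Qed.

Lemma eq_on_continuous U f g x : open U -> (forall y, U y -> f y = g y) -> U x ->
  {for x, continuous f} -> {for x, continuous g}.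
Proof.
move=> oU fg Ux cf; have E := near_open oU fg Ux.
change (g @ nbhs x --> g x); rewrite -(fg x Ux).
apply: cvg_trans cf; exact: near_eq_cvg.
Qed.

Lemma eq_on_derivable U f g x i : open U -> (forall y, U y -> f y = g y) -> U x ->
  derivable f x ('e_i : Rn) -> derivable g x ('e_i : Rn).
Proof.
move=> oU fg Ux; apply: near_eq_derivable.
exact: near_open Ux.
Qed.

Lemma eq_on_partial U f g x i : open U -> (forall y, U y -> f y = g y) -> U x ->
  partial i f x = partial i g x.
Proof.
move=> oU fg Ux; apply: near_eq_derive.
exact: near_open Ux.
Qed.

(** Coinduction for smoothness: the partial derivatives of members of [C] need to lie in [C] only up
    to equality on [U], because on an open set such equality passes to continuity and to further
    derivatives. *)
Lemma smooth_coind U (C : (Rn -> R) -> Prop) : open U ->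
  (forall h, C h -> forall x, U x ->
    {for x, continuous h} /\ forall i : 'I_n, derivable h x ('e_i : Rn)) ->
  (forall h i, C h -> exists h', C h' /\ forall x, U x -> partial i h x = h' x) ->
  forall h, C h -> smooth_on U h.
Proof.
move=> oU Creg Cpart h Ch s.
have [h' [Ch' hE]] : exists h', C h' /\ forall x, U x -> h' x = iter_partial s h x.
  elim: s => [|i s [h1 [Ch1 h1E]]]; first by exists h.
  have [h2 [Ch2 h2E]] := Cpart _ i Ch1; exists h2; split=> // x Ux.
  by rewrite -h2E //; exact: eq_on_partial h1E Ux.
move=> x Ux; have [ch' dh'] := Creg _ Ch' _ Ux.
split; first exact: eq_on_continuous hE Ux ch'.
by move=> i; exact: eq_on_derivable hE Ux (dh' i).
Qed.

Lemma analytic_smooth U h : open U -> analytic_on U h -> smooth_on U h.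
Proof.
move=> oU; apply: (@smooth_coind U (analytic_on U)) => // g.
  move=> /analyticE Cg x Ux; split; first exact/locexp_continuous/Cg.
  by move=> i; exact/locexp_derivable/Cg.
move=> i /analyticE Cg; exists (partial i g); split=> //.
by apply/analyticE => a Ua; exact/locexp_partial/Cg.
Qed.

Lemma analyticD U f g : analytic_on U f -> analytic_on U g ->
  analytic_on U (fun x => f x + g x).
Proof.
move=> /analyticE Cf /analyticE Cg; apply/analyticE => a Ua.
by apply: locexpD; [exact: Cf|exact: Cg].
Qed.

Lemma analyticM U f g : analytic_on U f -> analytic_on U g ->
  analytic_on U (fun x => f x * g x).
Proof.
move=> /analyticE Cf /analyticE Cg; apply/analyticE => a Ua.
by apply: locexpM; [exact: Cf|exact: Cg].
Qed.

Lemma analytic_const U (c : R) : analytic_on U (fun=> c).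
Proof. by apply/analyticE => a _; exact: locexp_const. Qed.

Lemma analytic_coord U i : analytic_on U (xcoord i).
Proof. by apply/analyticE => a _; exact: locexp_coord. Qed.

(** By the Leibniz rule a derivative of a product is a sum of products. This closure is stable under
    derivatives and fits [smooth_coind], which avoids a Leibniz formula for iterated partial
    derivatives. *)
Inductive smooth_ring U : (Rn -> R) -> Prop :=
| Smooth_base f of smooth_on U f : smooth_ring U f
| Smooth_add f g of smooth_ring U f & smooth_ring U g : smooth_ring U (fun x => f x + g x)
| Smooth_mul f g of smooth_ring U f & smooth_ring U g : smooth_ring U (fun x => f x * g x).

Lemma smooth_ring_reg U h : smooth_ring U h -> forall x, U x ->
  {for x, continuous h} /\ forall i : 'I_n, derivable h x ('e_i : Rn).
Proof.
elim=> [{}h sh|f g _ IHf _ IHg|f g _ IHf _ IHg] x Ux.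
- exact: (sh [::] x Ux).
- have [cf df] := IHf x Ux; have [cg dg] := IHg x Ux.
  split; first exact: (@cvgD _ _ _ (nbhs x)) cf cg.
  by move=> i; exact: derivableD (df i) (dg i).
- have [cf df] := IHf x Ux; have [cg dg] := IHg x Ux.
  split; first exact: (@cvgM _ _ (nbhs x)) cf cg.
  by move=> i; exact: derivableM (df i) (dg i).
Qed.

Lemma smooth_partial U f i : smooth_on U f -> smooth_on U (partial i f).
Proof.
move=> sf s x Ux.
have E t : iter_partial t (partial i f) = iter_partial (rcons t i) f.
  by rewrite /iter_partial foldr_rcons.
by rewrite E; exact: sf.
Qed.

Lemma partialD f g i x : derivable f x ('e_i : Rn) -> derivable g x ('e_i : Rn) ->
  partial i (fun y => f y + g y) x = partial i f x + partial i g x.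
Proof. exact: deriveD. Qed.

Lemma partialM f g i x : derivable f x ('e_i : Rn) -> derivable g x ('e_i : Rn) ->
  partial i (fun y => f y * g y) x = partial i f x * g x + f x * partial i g x.
Proof.
by move=> df dg; rewrite /partial [LHS](deriveM df dg) addrC mulrC.
Qed.

Lemma smooth_ring_smooth U h : open U -> smooth_ring U h -> smooth_on U h.
Proof.
move=> oU; apply: (@smooth_coind U (smooth_ring U)) => //; first exact: smooth_ring_reg.
move=> {}h i; elim=> [{}h sh|f g rf [f' [rf' fE]] rg [g' [rg' gE]]|
  f g rf [f' [rf' fE]] rg [g' [rg' gE]]].
- by exists (partial i h); split=> //; exact/Smooth_base/smooth_partial.
- exists (fun x => f' x + g' x); split; first exact: Smooth_add.
  move=> x Ux; rewrite partialD ?fE ?gE //.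
    by have [_ /(_ i)] := smooth_ring_reg rf Ux.
  by have [_ /(_ i)] := smooth_ring_reg rg Ux.
- exists (fun x => f' x * g x + f x * g' x); split.
    by apply: Smooth_add; exact: Smooth_mul.
  move=> x Ux; rewrite partialM ?fE ?gE //.
    by have [_ /(_ i)] := smooth_ring_reg rf Ux.
  by have [_ /(_ i)] := smooth_ring_reg rg Ux.
Qed.

Lemma smoothD U f g : open U -> smooth_on U f -> smooth_on U g ->
  smooth_on U (fun x => f x + g x).
Proof.
by move=> oU sf sg; apply: smooth_ring_smooth => //; apply: Smooth_add; exact: Smooth_base.
Qed.

Lemma smoothM U f g : open U -> smooth_on U f -> smooth_on U g ->
  smooth_on U (fun x => f x * g x).
Proof.
by move=> oU sf sg; apply: smooth_ring_smooth => //; apply: Smooth_mul; exact: Smooth_base.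
Qed.

Lemma smooth_const U (c : R) : open U -> smooth_on U (fun=> c).
Proof. by move=> oU; apply: analytic_smooth => //; exact: analytic_const. Qed.

Lemma smooth_coord U i : open U -> smooth_on U (xcoord i).
Proof. by move=> oU; apply: analytic_smooth => //; exact: analytic_coord. Qed.

Lemma smooth_continuous U f x : smooth_on U f -> U x -> {for x, continuous f}.
Proof. by move=> sf Ux; have [] := sf [::] x Ux. Qed.

Lemma smooth_derivable U f x i : smooth_on U f -> U x -> derivable f x ('e_i : Rn).
Proof. by move=> sf Ux; have [_] := sf [::] x Ux; exact. Qed.

End Smooth.

(** * Identity theorem, by restriction to segments *)

Section IdentityTheorem.
Context {R : realType} {n : nat}.
Local Notation Rn := 'rV[R]_n.
Local Notation expo := {ffun 'I_n -> nat}.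
Implicit Types (U : set Rn) (a x y v : Rn) (h : Rn -> R).

Lemma mono_scale (e : expo) s v : mono e (s *: v) = s ^+ edeg e * mono e v :> R.
Proof.
rewrite /mono /edeg expr_sum -big_split /=; apply: eq_bigr => i _.
by rewrite mxE exprMn.
Qed.

(** Terms of all blocks are collected by total degree. What remains after [K] degrees has degree at
    least [K], so each remaining term is at most its majorant times the [K]-th power of
    [|s| / rho]. *)
Lemma line_taylor y v h : locexp y h -> (forall j, `|v ord0 j| <= 1) ->
  exists (rho M : R) (A : nat -> R), 0 < rho /\ forall K s, `|s| < rho ->
    `|h (y + s *: v) - \sum_(j < K) A j * s ^+ j| <= M * (`|s| / rho) ^+ K.
Proof.
move=> [rho [M [L [r0 [HM HL]]]]] v1.
have mv e : `|mono e v| <= 1 by rewrite (le_trans (mono_le e v1)) // expr1n.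
pose B j m := \sum_(t <- L m | edeg t.2 == j) t.1 * mono t.2 v.
have /choice[A HA] j : exists A : R, psum (B j) @ \oo --> A.
  apply: (@psum_cvg R _ (M / rho ^+ j)) => N; rewrite ler_pdivlMr ?exprn_gt0 //.
  apply: le_trans (HM N); rewrite /psum mulr_suml; apply: ler_sum => m _.
  rewrite (le_trans (ler_wpM2r (exprn_ge0 _ (ltW r0)) (ler_norm_sum _ _ _))) //.
  rewrite mulr_suml /lnorm big_mkcond; apply: ler_sum => t _ /=.
  case: eqP => [<-|_]; last by rewrite mulr_ge0 // exprn_ge0 // ltW.
  by rewrite ler_wpM2r ?exprn_ge0 ?(ltW r0) // normrM ler_piMr.
exists rho, M, A; split=> // K s sr.
have yb : ball y rho (y + s *: v).
  apply/(ball_rV _ _ r0) => j; rewrite !mxE addrAC subrr add0r normrM.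
  by apply: le_lt_trans sr; rewrite ler_piMr.
have lim : (fun N => psum (fun m => leval (L m) (s *: v)) N - \sum_(j < K) psum (B j) N * s ^+ j)
    @ \oo --> h (y + s *: v) - \sum_(j < K) A j * s ^+ j.
  apply: cvgB.
    have -> : (fun m => leval (L m) (s *: v)) = (fun m => leval (L m) (y + s *: v - y)).
      by rewrite addrAC subrr add0r.
    exact: HL.
  by apply: cvg_lsum => j; apply: cvgMl; exact: HA.
apply: (cvgr_to_le (cvg_norm lim)); apply: nearW => N.
have q0 : 0 <= `|s| / rho by rewrite divr_ge0 // ltW.
apply: le_trans (_ : psum (fun m => lnorm rho (L m)) N * (`|s| / rho) ^+ K <= _); last first.
  by rewrite ler_wpM2r // exprn_ge0.
rewrite /psum; under [\sum_(j < K) _]eq_bigr do rewrite mulr_suml.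
rewrite exchange_big /= -sumrB mulr_suml.
apply: le_trans (ler_norm_sum _ _ _) _; apply: ler_sum => m _.
have -> : \sum_(j < K) B j m * s ^+ j =
    \sum_(t <- L m | (edeg t.2 < K)%N) t.1 * mono t.2 (s *: v).
  rewrite /B; elim: (L m) => [|t l IH].
    by rewrite big_nil big1 // => j _; rewrite big_nil mul0r.
  rewrite big_cons -IH.
  have E (j : 'I_K) : (\sum_(t0 <- t :: l | edeg t0.2 == j) t0.1 * mono t0.2 v) * s ^+ j =
     (if edeg t.2 == j then t.1 * mono t.2 (s *: v) else 0) +
     (\sum_(t0 <- l | edeg t0.2 == j) t0.1 * mono t0.2 v) * s ^+ j.
    rewrite big_cons; case: eqP => [<-|_]; last by rewrite add0r.
    by rewrite mulrDl mono_scale; congr (_ + _); rewrite -mulrA; congr (_ * _); rewrite mulrC.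
  under eq_bigr do rewrite E.
  rewrite big_split /= -big_mkcond /=; case: ltnP => tK.
    by rewrite (big_pred1 (Ordinal tK)) // => j; rewrite eq_sym.
  rewrite big1 ?add0r // => j /eqP tj; move: (ltn_ord j).
  by rewrite -tj ltnNge tK.
rewrite /leval (bigID (fun t => (edeg t.2 < K)%N)) /= addrAC subrr add0r.
apply: le_trans (ler_norm_sum _ _ _) _; rewrite mulr_suml big_mkcond /=.
apply: ler_sum => -[c e] _ /=; case: ltnP => /= eK.
  by rewrite mulr_ge0 ?exprn_ge0 // mulr_ge0 // exprn_ge0 // ltW.
rewrite mono_scale !normrM normrX -mulrA ler_wpM2l //.
apply: le_trans (_ : `|s| ^+ edeg e <= _); first by rewrite ler_piMr ?exprn_ge0.
rewrite -{1}[`|s|](divfK (lt0r_neq0 r0)) exprMn mulrC ler_wpM2l ?exprn_ge0 ?(ltW r0) //.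
rewrite -(subnK eK) exprD ler_piMl ?exprn_ge0 // exprn_ile1 //.
by rewrite ler_pdivrMr // mul1r ltW.
Qed.

(** If the coefficients below [K] vanish, the remainder bound makes [A K] at most a constant times
    [s] for small positive [s], by evaluating at [- s]; hence all coefficients are 0. The remainder
    bound for [K] tending to infinity then kills [phi]. Vanishing on one side is what is known at
    the end of an interval. *)
Lemma flat_zero (phi : R -> R) (rho M e : R) (A : nat -> R) : 0 < rho -> 0 < e ->
  (forall K s, `|s| < rho -> `|phi s - \sum_(j < K) A j * s ^+ j| <= M * (`|s| / rho) ^+ K) ->
  (forall s, - e < s < 0 -> phi s = 0) ->
  forall s, `|s| < rho -> phi s = 0.
Proof.
move=> r0 e0 H phi0.
have A0 K : A K = 0.
  elim/ltn_ind: K => K IH; pose C := M / rho ^+ K.+1.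
  have HC s : 0 < s -> s < e -> s < rho -> `|A K| <= C * s.
    move=> s0 se sr; have := H K.+1 (- s).
    rewrite phi0; last by rewrite ltrN2 se oppr_lt0.
    rewrite normrN gtr0_norm // sub0r normrN => /(_ sr).
    rewrite big_ord_recr /= big1 ?add0r => [|j _]; last by rewrite IH ?mul0r.
    rewrite normrM normrX normrN (gtr0_norm s0) expr_div_n mulrA mulrAC -/C exprS mulrA.
    by rewrite ler_pM2r // exprn_gt0.
  apply/eqP; rewrite -normr_eq0; apply/eqP/le_anti; rewrite normr_ge0 andbT.
  rewrite leNgt; apply/negP => AK0.
  pose d := `|A K| / (2 * (`|C| + 1)).
  have C1 : 0 < `|C| + 1 by rewrite ltr_wpDl.
  have d0 : 0 < d by rewrite divr_gt0 // mulr_gt0.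
  pose s := Num.min (e / 2) (Num.min (rho / 2) d).
  have s0 : 0 < s by rewrite !lt_min d0 !divr_gt0.
  have se : s < e by rewrite /s gt_min; apply/orP; left; lra.
  have sr : s < rho by rewrite /s !gt_min; apply/orP; right; apply/orP; left; lra.
  have sd : s <= d by rewrite /s !ge_min lexx !orbT.
  have := HC s s0 se sr; apply/negP; rewrite -ltNge.
  apply: le_lt_trans (_ : _ <= `|C| * s) _; first by rewrite ler_wpM2r ?(ltW s0) // ler_norm.
  apply: le_lt_trans (_ : _ <= (`|C| + 1) * d) _.
    by apply: ler_pM; rewrite ?(ltW s0) // lerDl.
  have -> : (`|C| + 1) * d = `|A K| / 2 by rewrite /d; field; rewrite lt0r_neq0.
  by rewrite ltr_pdivrMr // ltr_pMr // ltr1n.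
move=> s sr; have q1 : Num.norm (`|s| / rho) < 1.
  by rewrite ger0_norm ?divr_ge0 ?(ltW r0) // ltr_pdivrMr // mul1r.
have lim : (fun K => M * (`|s| / rho) ^+ K) @ \oo --> (0 : R).
  by rewrite -[X in _ --> X](mulr0 M); apply: cvgM (cvg_expr q1); exact: cvg_cst.
apply/eqP; rewrite -normr_le0.
apply: (cvgr_to_ge lim); apply: nearW => K /=.
by have := H K s sr; rewrite big1 ?subr0 // => j _; rewrite A0 mul0r.
Qed.

(** Continuation past the supremum [T] of the parameters up to which [h] vanishes: the expansion at
    [T] is zero on the left, hence on both sides, so [T] cannot stop short of 1. *)
Lemma analytic_segment U h x v : analytic_on U h -> (forall j, `|v ord0 j| <= 1) ->
  (forall t, 0 <= t <= 1 -> U (x + t *: v)) ->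
  (exists2 e, 0 < e & forall t, 0 <= t < e -> h (x + t *: v) = 0) ->
  h (x + v) = 0.
Proof.
move=> /analyticE hU v1 xvU [e e0 he].
pose S := [set t : R | 0 <= t <= 1 /\ forall s, 0 <= s <= t -> h (x + s *: v) = 0].
have S0 : S 0.
  split=> [|s]; first by rewrite lexx ler01.
  by move=> /le_anti <-; apply: he; rewrite lexx e0.
have ubS : ubound S 1 by move=> t [/andP[]].
have hsS : has_sup S by split; [exists 0|exists 1].
pose T := sup S.
have leT t : S t -> t <= T by move=> St; exact: (sup_upper_bound hsS).
have T1 : T <= 1 by apply: ge_sup => //; exists 0.
have T0 : 0 < T.
  have m0 : 0 < Num.min (e / 2) 1 by rewrite lt_min ltr01 divr_gt0.
  apply: (lt_le_trans m0); apply: leT; split.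
    by rewrite (ltW m0) /= ge_min lexx orbT.
  move=> s /andP[s0]; rewrite le_min => /andP[se _]; apply: he.
  by rewrite s0 (le_lt_trans se) // ltr_pdivrMr // ltr_pMr // ltr1n.
have below s : 0 <= s < T -> h (x + s *: v) = 0.
  move=> /andP[s0 sT].
  have sT0 : 0 < T - s by rewrite subr_gt0.
  have [t St st] := sup_adherent sT0 hsS.
  by apply: St.2; rewrite s0 ltW //; move: st; rewrite /T; lra.
have UT : U (x + T *: v) by apply: xvU; rewrite (ltW T0).
have [rho [M [A [r0 HA]]]] := line_taylor (hU _ UT) v1.
have aboveT s : `|s| < rho -> h (x + T *: v + s *: v) = 0.
  apply: (flat_zero r0 T0 HA) => u /andP[Tu u0].
  by rewrite -addrA -scalerDl below //; lra.
have ST : S (Num.min 1 (T + rho / 2)).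
  split; first by rewrite le_min ler01 ge_min lexx /= andbT ltW //; lra.
  move=> s /andP[s0]; rewrite le_min => /andP[s1 sT].
  case: (ltP s T) => [sltT|Ts]; first by apply: below; rewrite s0.
  have -> : x + s *: v = x + T *: v + (s - T) *: v by rewrite -addrA -scalerDl (addrC T) subrK.
  by apply: aboveT; rewrite ger0_norm ?subr_ge0 //; lra.
have := leT _ ST; rewrite ge_min => /orP[T1'|]; last by lra.
have := ST.2 1; rewrite scale1r; apply; rewrite ler01 le_min lexx /=.
by lra.
Qed.

(** The interior of the zero set is closed in [U]: a point [y] near a limit point [x] is joined,
    inside a ball, to a point [b] of that interior, and vanishing propagates along the segment. *)
Lemma analytic_identity U V h : connected U -> open U -> analytic_on U h ->
  open V -> V `<=` U -> V !=set0 -> (forall x, V x -> h x = 0) ->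
  forall x, U x -> h x = 0.
Proof.
move=> cU oU hU oV VU [v0 Vv0] hV.
pose Z := [set x | h x = 0].
have VZ : V `<=` Z° by rewrite -open_subsetE // => x /hV.
suff E : U `&` Z° = U by move=> x; rewrite -E => -[_ /interior_subset].
apply: cU.
- by exists v0; split; [exact: VU|exact: VZ].
- by exists Z°; [exact: open_interior|].
- exists (closure (U `&` Z°)); first exact: closed_closure.
  apply/seteqP; split=> [x [Ux Zx]|x [Ux cx]].
    by split=> //; exact: subset_closure.
  split=> //.
  have [r r0 rU] : exists2 r : R, 0 < r & ball x r `<=` U.
    by have /nbhs_ballP[r /= r0 rU] := open_nbhs_nbhs (conj oU Ux); exists r.
  (* The bound [1 / 2] makes every coordinate of [y - b] at most 1, as [analytic_segment] requires
     of its direction. *)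
  pose d := Num.min r (1 / 2).
  have d0 : 0 < d by rewrite lt_min r0 divr_gt0.
  have dr : d <= r by rewrite ge_min lexx.
  have d2 : d <= 1 / 2 by rewrite ge_min lexx orbT.
  apply/nbhs_ballP; exists d => //= y yd.
  have [b [[Ub Zb] bd]] := cx _ (nbhsx_ballx _ _ d0).
  have := yd; move=> /(ball_rV _ _ d0) yd'; have := bd; move=> /(ball_rV _ _ d0) bd'.
  have yE : y = b + (y - b) by rewrite addrC subrK.
  rewrite /Z /= yE; apply: (analytic_segment hU).
  + move=> j; rewrite !mxE.
    rewrite (_ : _ - _ = (y ord0 j - x ord0 j) - (b ord0 j - x ord0 j)); last by ring.
    apply: le_trans (ler_normB _ _) _.
    by have := yd' j; have := bd' j; lra.
  + move=> t /andP[t0 t1]; apply: rU; apply: le_ball dr _ _.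
    apply/(ball_rV _ _ d0) => j; rewrite !mxE.
    rewrite (_ : _ + _ - _ = t * (y ord0 j - x ord0 j) + (1 - t) * (b ord0 j - x ord0 j)); last by ring.
    apply: le_lt_trans (ler_normD _ _) _; rewrite !normrM (ger0_norm t0) (@ger0_norm _ (1 - t)) ?subr_ge0 //.
    have md : Num.max `|y ord0 j - x ord0 j| `|b ord0 j - x ord0 j| < d by rewrite gt_max yd' bd'.
    apply: le_lt_trans md; set m := Num.max _ _.
    have my : `|y ord0 j - x ord0 j| <= m by rewrite /m le_max lexx.
    have mb : `|b ord0 j - x ord0 j| <= m by rewrite /m le_max lexx orbT.
    have t1' : 0 <= 1 - t by rewrite subr_ge0.
    have := lerD (ler_wpM2l t0 my) (ler_wpM2l t1' mb).
    by rewrite -mulrDl (addrC t) subrK mul1r.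
  + have [/= e e0 he] := (nbhs_ballP _ _).1 Zb.
    exists e => // t /andP[t0 te]; apply: (he).
    apply/(ball_rV _ _ e0) => j; rewrite !mxE addrAC subrr add0r normrM (ger0_norm t0).
    apply: le_lt_trans te; rewrite ler_piMr //.
    rewrite (_ : _ - _ = (y ord0 j - x ord0 j) - (b ord0 j - x ord0 j)); last by ring.
    apply: le_trans (ler_normB _ _) _.
    by have := yd' j; have := bd' j; lra.
Qed.

End IdentityTheorem.

(** * Nash functions *)

Section PolynomialFunctions.
Context {R : realType} {n : nat}.
Local Notation Rn := 'rV[R]_n.
Local Notation mp := (mpoly.mpoly n R).
Local Notation "p @[ x ]" := (mpoly.meval (fun i => (x : Rn) ord0 i) p)
  (at level 2, x at level 200, format "p @[ x ]").
Implicit Types (U : set Rn) (f g : Rn -> R) (p : mp).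

Lemma poly_zero_near (q : {poly R}) (e : R) : 0 < e ->
  (forall t, `|t| < e -> q.[t] = 0) -> q = 0.
Proof.
move=> e0 H; apply/eqP/negPn/negP => q0.
have := @max_poly_roots _ q [seq e / k.+2%:R | k <- iota 0 (size q)] q0.
rewrite size_map size_iota ltnn => F; suff: false by []; apply: F.
  apply/allP => _ /mapP[k _ ->]; apply/rootP/H.
  by rewrite ger0_norm ?divr_ge0 ?(ltW e0) // ltr_pdivrMr // ltr_pMr // ltr1n.
rewrite map_inj_uniq ?iota_uniq // => j k /(mulfI (lt0r_neq0 e0)) /invr_inj /eqP.
by rewrite eqr_nat => /eqP[].
Qed.

(** Uniqueness of digits in base [B]: distinct monomials keep distinct degrees under a Kronecker
    substitution. *)
Lemma digits_inj (B : nat) m (f g : 'I_m -> nat) :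
  (forall i, (f i < B)%N) -> (forall i, (g i < B)%N) ->
  (\sum_i f i * B ^ i = \sum_i g i * B ^ i)%N -> f =1 g.
Proof.
elim: m f g => [f g _ _ _ []//|m IH f g fB gB].
rewrite !big_ord_recl /= !expn0 !muln1.
have E (h : 'I_m.+1 -> nat) : (\sum_(i < m) h (lift ord0 i) * B ^ bump 0 i =
    (\sum_(i < m) h (lift ord0 i) * B ^ i) * B)%N.
  by rewrite big_distrl; apply: eq_bigr => i _; rewrite /bump /= expnSr mulnA.
rewrite !E => H.
have H0 : f ord0 = g ord0.
  by have := congr1 (modn^~ B) H; rewrite /= !(addnC _ (_ * B)%N) !modnMDl !modn_small.
move: H; rewrite H0 => /addnI /eqP; rewrite eqn_pmul2r; last exact: leq_ltn_trans (fB ord0).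
move=> /eqP /(IH _ _ (fun i => fB (lift ord0 i)) (fun i => gB (lift ord0 i))) => H i.
by case: (unliftP ord0 i) => [j|] ->//; exact: H.
Qed.

Lemma meval_all_zero p : (forall x, p@[x] = 0) -> p = 0.
Proof.
move=> H; apply/eqP/negPn/negP => p0.
have : mpoly.msupp p != [::].
  by apply: contra p0 => /eqP E; rewrite [p]mpoly.mpolyE E big_nil.
case Ep : (mpoly.msupp p) => [//|m0 ms] _.
have m0p : m0 \in mpoly.msupp p by rewrite Ep mem_head.
pose B := (\max_(m <- mpoly.msupp p) \max_i m i).+1.
have mB m i : m \in mpoly.msupp p -> (m i < B)%N.
  move=> mp'; rewrite ltnS; apply: leq_trans (leq_bigmax i) _.
  exact: (leq_bigmax_seq (F := fun m : mpoly.multinom n => \max_i m i) _ mp').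
pose k (m : mpoly.multinom n) := (\sum_i m i * B ^ i)%N.
(* Kronecker substitution: the i-th variable becomes 'X^(B ^ i). *)
pose q : {poly R} := \sum_(m <- mpoly.msupp p) mpoly.mcoeff m p *: 'X^(k m).
have q0 : q = 0.
  apply: (@poly_zero_near _ 1) => // t _.
  rewrite -[RHS](H (\row_i t ^+ (B ^ i))) mpoly.mevalE /q horner_sum.
  apply: eq_bigr => m _; rewrite hornerZ hornerXn; congr (_ * _).
  by rewrite /k expr_sum; apply: eq_bigr => i _; rewrite mxE -exprM mulnC.
have := congr1 (fun u : {poly R} => u`_(k m0)) q0.
rewrite coef0 /q coef_sum (bigD1_seq m0) ?mpoly.msupp_uniq //=.
rewrite coefZ coefXn eqxx mulr1 big1_seq ?addr0.
  by move/eqP; apply/negP; rewrite -mpoly.mcoeff_msupp.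
move=> m /andP[mm0 mp']; rewrite coefZ coefXn; case: eqP => [km|_]; last by rewrite mulr0.
case/eqP: mm0; apply/mpoly.mnmP => i; apply: (@digits_inj B) => [j|j|].
- exact: mB.
- exact: mB.
- exact/esym.
Qed.

(** Along the line from a point [a] of [U] to any [x], the polynomial becomes one in [t] that
    vanishes near 0; it therefore vanishes at [t = 1]. *)
Lemma meval_zero U p : open U -> U !=set0 -> (forall x, U x -> p@[x] = 0) -> p = 0.
Proof.
move=> oU [a Ua] H; apply: meval_all_zero => x.
have [r /= r0 rU] := (nbhs_ballP _ _).1 (open_nbhs_nbhs (conj oU Ua)).
pose q : {poly R} := \sum_(m <- mpoly.msupp p) mpoly.mcoeff m p *:
  \prod_i ((a ord0 i)%:P + (x ord0 i - a ord0 i) *: 'X) ^+ m i.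
have qE t : q.[t] = p@[a + t *: (x - a)].
  rewrite /q horner_sum mpoly.mevalE; apply: eq_bigr => m _.
  rewrite hornerZ horner_prod; congr (_ * _); apply: eq_bigr => i _.
  by rewrite horner_exp hornerD hornerC hornerZ hornerX !mxE mulrC.
suff q0 : q = 0 by have := qE 1; rewrite q0 horner0 scale1r addrC subrK => <-.
have n1 : 0 < `|x - a| + 1 by rewrite ltr_wpDl.
apply: (@poly_zero_near _ (r / (`|x - a| + 1))); first exact: divr_gt0.
move=> t; rewrite ltr_pdivlMr // => tr; rewrite qE; apply/H/rU.
rewrite -ball_normE /= opprD addrA subrr sub0r normrN normrZ.
by apply: le_lt_trans tr; rewrite ler_wpM2l // lerDl.
Qed.

Lemma meval_closed (C : (Rn -> R) -> Prop) p :
  (forall c, C (fun=> c)) -> (forall i, C (xcoord i)) ->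
  (forall f g, C f -> C g -> C (fun x => f x + g x)) ->
  (forall f g, C f -> C g -> C (fun x => f x * g x)) ->
  C (fun x => p@[x]).
Proof.
move=> C0 CX CD CM.
have -> : (fun x => p@[x]) = fun x : Rn =>
    \sum_(m <- mpoly.msupp p) mpoly.mcoeff m p * \prod_(i <- enum 'I_n) x ord0 i ^+ m i.
  by apply/funext => x; rewrite mpoly.mevalE; apply: eq_bigr => m _; rewrite big_enum.
have Cexp i k : C (fun x => x ord0 i ^+ k).
  elim: k => [|k IH]; first exact: C0.
  under eq_fun do rewrite exprS.
  exact: CM (CX i) IH.
elim: (mpoly.msupp p) => [|m s IH]; first by under eq_fun do rewrite big_nil.
under eq_fun do rewrite big_cons.
apply: (CD) => //; apply: (CM) => //.
elim: (enum 'I_n) => [|i r IHr]; first by under eq_fun do rewrite big_nil.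
under eq_fun do rewrite big_cons.
exact: CM.
Qed.

Definition pevl (P : {poly mp}) f : Rn -> R :=
  fun x => (map_poly (mpoly.meval (fun i => x ord0 i)) P).[f x].

Lemma pevl0 f : pevl 0 f = fun=> 0.
Proof. by apply/funext => x; rewrite /pevl rmorph0 horner0. Qed.

Lemma pevlMX P p f : pevl (P * 'X + p%:P) f = fun x => pevl P f x * f x + p@[x].
Proof.
by apply/funext => x; rewrite /pevl rmorphD rmorphM /= map_polyX map_polyC !hornerE.
Qed.

Lemma pevl_closed (C : (Rn -> R) -> Prop) (P : {poly mp}) f :
  (forall c, C (fun=> c)) -> (forall i, C (xcoord i)) ->
  (forall f g, C f -> C g -> C (fun x => f x + g x)) ->
  (forall f g, C f -> C g -> C (fun x => f x * g x)) ->
  C f -> C (pevl P f).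
Proof.
move=> C0 CX CD CM Cf; elim/poly_ind: P => [|P p IH]; first by rewrite pevl0.
by rewrite pevlMX; apply: (CD); [exact: CM|exact: meval_closed].
Qed.

End PolynomialFunctions.

(** * Sums and products of Nash functions, through integrality *)

Section NashAlgebra.
Context {R : realType} {n : nat}.
Local Notation Rn := 'rV[R]_n.
Local Notation mp := (mpoly.mpoly n R).
Local Notation "p @[ x ]" := (mpoly.meval (fun i => (x : Rn) ord0 i) p)
  (at level 2, x at level 200, format "p @[ x ]").
Implicit Types (U : set Rn) (f g : Rn -> R) (p : mp) (P : {poly mp}).

Definition algebraic_on U f := exists2 P : {poly mp}, P != 0 &
  forall x, U x -> pevl P f x = 0.

(* [rho] is meant to be a retraction onto [U]; it turns identities on [U] into
   identities in the ring of all functions. *)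
Definition pullback (rho : Rn -> Rn) (p : mp) : Rn -> R := fun x => p@[rho x].

Section Pullback.
Context (rho : Rn -> Rn).
Lemma pullback_zmod : zmod_morphism (pullback rho).
Proof. by move=> p q; apply/funext => x; rewrite /pullback rmorphB. Qed.
Lemma pullback_monoid : monoid_morphism (pullback rho).
Proof.
split; first by apply/funext => x; rewrite /pullback rmorph1.
by move=> p q; apply/funext => x; rewrite /pullback rmorphM.
Qed.
HB.instance Definition _ := GRing.isZmodMorphism.Build mp (Rn -> R) (pullback rho) pullback_zmod.
HB.instance Definition _ := GRing.isMonoidMorphism.Build mp (Rn -> R) (pullback rho) pullback_monoid.
End Pullback.

Lemma fct_exprE (f : Rn -> R) k x : (f ^+ k) x = f x ^+ k.
Proof. by elim: k => [|k IH]; rewrite ?expr0 ?exprS //= -IH. Qed.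

Lemma pullback_horner rho P f x :
  (map_poly (pullback rho) P).[f] x = (map_poly (mpoly.meval (fun i => (rho x) ord0 i)) P).[f x].
Proof.
rewrite (@horner_coef_wide _ (size P)) ?size_poly //.
rewrite (@horner_coef_wide _ (size P) (map_poly _ _)) ?size_poly //.
rewrite fct_sumE; apply: eq_bigr => i _.
by rewrite !coef_map /= -fct_exprE.
Qed.

(** Integral elements are closed under sums and products over any commutative ring, even in a ring
    of functions full of zero divisors. Multiplying by the leading coefficient makes an algebraic
    function integral. *)
Lemma algebraic_integral (rho : Rn -> Rn) U f : (forall x, U (rho x)) ->
  algebraic_on U f -> exists2 a : mp, a != 0 &
    integralOver (pullback rho) (pullback rho a * (f \o rho)).
Proof.
move=> rU [P P0 HP].
(* The factor 'X makes the degree positive. *)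
pose a := lead_coef P; pose d := size P; pose K := 'X * P.
exists a; first by rewrite lead_coef_eq0.
pose Q : {poly mp} := 'X^d + \poly_(i < d) (K`_i * a ^+ (d.-1 - i)).
have d0 : (0 < d)%N by rewrite size_poly_gt0.
exists Q.
  rewrite monicE lead_coefDl ?lead_coefXn // size_polyXn.
  exact: leq_ltn_trans (size_poly _ _) _.
apply/rootP/funext => x; rewrite pullback_horner.
set ev := mpoly.meval _; pose u := ev a; pose y := f (rho x).
have -> : (pullback rho a * (f \o rho)) x = u * y by [].
have H : (map_poly ev P).[y] = 0 by exact: HP.
suff E : (map_poly ev Q).[u * y] = u ^+ d.-1 * (y * (map_poly ev P).[y]).
  by rewrite E H !mulr0.
have -> : y * (map_poly ev P).[y] = (map_poly ev K).[y].
  by rewrite /K rmorphM /= map_polyX hornerM hornerX.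
have sK : size K = d.+1 by rewrite /K mulrC size_mulX.
rewrite (@horner_coef_wide _ d.+1 (map_poly ev K)); last first.
  by rewrite -sK size_poly.
rewrite big_ord_recr /= coef_map /= mulrDr mulr_sumr.
have -> : K`_d = a by rewrite /K coefXM gtn_eqF.
rewrite rmorphD /= map_polyXn hornerD hornerXn addrC; congr (_ + _); last first.
  by rewrite exprMn mulrA -exprSr prednK.
rewrite (@horner_coef_wide _ d); last exact: leq_trans (size_poly _ _) (size_poly _ _).
apply: eq_bigr => i _; rewrite !coef_map /= coef_poly ltn_ord rmorphM rmorphXn /=.
have -> : u ^+ d.-1 = u ^+ (d.-1 - i) * u ^+ i by rewrite -exprD subnK // -ltnS prednK.
rewrite exprMn -/ev -/u; ring.
Qed.

Lemma integral_algebraic_on (rho : Rn -> Rn) U f (a : mp) :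
  (forall x, U x -> rho x = x) -> a != 0 ->
  integralOver (pullback rho) (pullback rho a * (f \o rho)) -> algebraic_on U f.
Proof.
move=> rE a0 [Q monQ /rootP rootQ].
exists (\poly_(i < size Q) (Q`_i * a ^+ i)).
  apply/eqP => /polyP /(_ (size Q).-1); rewrite coef0 coef_poly.
  have Q0 : (0 < size Q)%N by rewrite size_poly_gt0 monic_neq0.
  rewrite prednK // leqnn -lead_coefE (monicP monQ) mul1r => /eqP.
  by rewrite expf_eq0 (negbTE a0) andbF.
move=> x Ux; have := congr1 (fun h : Rn -> R => h x) rootQ.
rewrite pullback_horner rE // /pevl.
rewrite (@horner_coef_wide _ (size Q)) ?size_poly // => E.
rewrite (@horner_coef_wide _ (size Q)); last exact: leq_trans (size_poly _ _) (size_poly _ _).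
rewrite -[RHS]E; apply: eq_bigr => i _; rewrite !coef_map /= coef_poly ltn_ord.
rewrite rmorphM rmorphXn /= -mulrA -exprMn; congr (_ * (_ * _) ^+ _).
  by rewrite /pullback rE.
by rewrite /= rE.
Qed.

Lemma retraction U : U !=set0 -> exists rho : Rn -> Rn,
  (forall x, U (rho x)) /\ forall x, U x -> rho x = x.
Proof.
move=> [u Uu]; exists (fun x => if `[<U x>] then x else u).
by split=> x; [case: asboolP|move=> Ux; case: asboolP].
Qed.

Lemma algebraicD U f g : U !=set0 -> algebraic_on U f -> algebraic_on U g ->
  algebraic_on U (fun x => f x + g x).
Proof.
move=> /retraction[rho [rU rE]] /(algebraic_integral rU)[a a0 Ia] /(algebraic_integral rU)[b b0 Ib].
apply: (@integral_algebraic_on rho _ _ (a * b)) => //; first by rewrite mulf_neq0.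
have := integral_add (integral_mul (integral_id (pullback rho) b) Ia)
  (integral_mul (integral_id (pullback rho) a) Ib).
congr (integralOver _ _); rewrite rmorphM /=.
rewrite (_ : (fun x => f x + g x) \o rho = (f \o rho) + (g \o rho)) //.
by rewrite mulrDr mulrA [in LHS]mulrA; congr (_ * _ + _); exact: mulrC.
Qed.

Lemma algebraicM U f g : U !=set0 -> algebraic_on U f -> algebraic_on U g ->
  algebraic_on U (fun x => f x * g x).
Proof.
move=> /retraction[rho [rU rE]] /(algebraic_integral rU)[a a0 Ia] /(algebraic_integral rU)[b b0 Ib].
apply: (@integral_algebraic_on rho _ _ (a * b)) => //; first by rewrite mulf_neq0.
have := integral_mul Ia Ib; rewrite mulrACA -rmorphM.
by congr (integralOver _ _).
Qed.

Lemma algebraic_meval U p : algebraic_on U (fun x => p@[x]).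
Proof.
exists ('X - p%:P); first by rewrite polyXsubC_eq0.
by move=> x _; rewrite /pevl rmorphB /= map_polyX map_polyC !hornerE subrr.
Qed.

Lemma nashD U f g : U !=set0 -> nash_on U f -> nash_on U g ->
  nash_on U (fun x => f x + g x).
Proof.
by move=> U0 [af Pf] [ag Pg]; split; [exact: analyticD|exact: algebraicD].
Qed.

Lemma nashM U f g : U !=set0 -> nash_on U f -> nash_on U g ->
  nash_on U (fun x => f x * g x).
Proof.
by move=> U0 [af Pf] [ag Pg]; split; [exact: analyticM|exact: algebraicM].
Qed.

Lemma nash_const U (c : R) : nash_on U (fun=> c).
Proof.
split; first exact: analytic_const.
have := algebraic_meval U (mpoly.mpolyC n c); congr algebraic_on.
by apply/funext => x; rewrite mpoly.mevalC.
Qed.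

Lemma nash_coord U i : nash_on U (xcoord i).
Proof.
split; first exact: analytic_coord.
have := algebraic_meval U (mpoly.mpolyX R (mpoly.mnm1 i)); congr algebraic_on.
by apply/funext => x; rewrite mpoly.mevalXU.
Qed.

Lemma nash_pevl U P f : U !=set0 -> nash_on U f -> nash_on U (pevl P f).
Proof.
move=> U0 nf; apply: (@pevl_closed _ _ (nash_on U)) => //.
- exact: nash_const.
- exact: nash_coord.
- by move=> ? ?; exact: nashD.
- by move=> ? ?; exact: nashM.
Qed.

Lemma analytic_pevl U P f : analytic_on U f -> analytic_on U (pevl P f).
Proof.
move=> nf; apply: (@pevl_closed _ _ (analytic_on U)) => //.
- exact: analytic_const.
- exact: analytic_coord.
- by move=> ? ?; exact: analyticD.
- by move=> ? ?; exact: analyticM.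
Qed.

End NashAlgebra.

(** * Kähler relations *)

Section Pairing.
Context {R : realType} {A : @setoid_alg R}.
Implicit Types (w : fsum A) (a b h k : sa_car A).

(** A functional on formal sums. With [delta h0] as [tau] it computes the coefficient of a symbol;
    with a derivation along [phi] as [tau] it kills the Kähler relations. *)
Definition pairing (phi tau : sa_car A -> R) w : R := \sum_(t <- w) phi t.1 * tau t.2.

Definition delta (h0 h : sa_car A) : R := if `[< sa_eqv A h h0 >] then 1 else 0.

Context (phi tau : sa_car A -> R)
  (phiM : forall a b, phi (sa_mul A a b) = phi a * phi b)
  (phiN : forall a, phi (sa_opp A a) = - phi a)
  (phi1 : phi (sa_one A) = 1)
  (phiZ : forall c a, phi (sa_scal A c a) = c * phi a).

Lemma pairing_cat w1 w2 : pairing phi tau (w1 ++ w2) = pairing phi tau w1 + pairing phi tau w2.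
Proof. exact: big_cat. Qed.

Lemma pairing_scale b w : pairing phi tau (fs_scale b w) = phi b * pairing phi tau w.
Proof.
by rewrite /pairing big_map mulr_sumr; apply: eq_bigr => t _; rewrite phiM mulrA.
Qed.

Lemma pairing_sub w1 w2 : pairing phi tau (fs_sub w1 w2) = pairing phi tau w1 - pairing phi tau w2.
Proof. by rewrite pairing_cat pairing_scale phiN phi1 mulN1r. Qed.

Lemma pairing_d h : pairing phi tau (fs_d h) = tau h.
Proof. by rewrite /pairing big_seq1 /= phi1 mul1r. Qed.

Lemma pairing_sum (I : Type) (r : seq I) (F : I -> fsum A) :
  pairing phi tau (fs_sum [seq F i | i <- r]) = \sum_(i <- r) pairing phi tau (F i).
Proof. by rewrite /pairing big_flatten big_map. Qed.

Lemma pairing_kgen (e : kgen (sa_car A)) : pairing phi tau (kgen_elem e) =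
  match e with
  | KAdd h k => tau (sa_add A h k) - (tau h + tau k)
  | KScal c h => tau (sa_scal A c h) - c * tau h
  | KMul h k => tau (sa_mul A h k) - (phi h * tau k + phi k * tau h)
  end.
Proof.
case: e => [h k|c h|h k]; rewrite /kgen_elem pairing_sub pairing_d ?pairing_cat.
- by rewrite !pairing_d.
- by rewrite pairing_scale phiZ phi1 mulr1 pairing_d.
- by rewrite !pairing_scale !pairing_d.
Qed.

(** The predicate [good] is there for fractions: their evaluation at a point is additive only where
    the denominators do not vanish. *)
Lemma fs_coef_pairing (good : sa_car A -> Prop) w h0 :
  good (sa_zero A) -> phi (sa_zero A) = 0 ->
  (forall a b, good a -> good b ->
    good (sa_add A a b) /\ phi (sa_add A a b) = phi a + phi b) ->
  (forall t, List.In t w -> good t.1) ->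
  good (fs_coef w h0) /\ phi (fs_coef w h0) = pairing phi (delta h0) w.
Proof.
move=> g0 p0 gD; elim: w => [_|t w IH gw]; first by rewrite /pairing big_nil.
have [g1 IH1] := IH (fun u uw => gw u (or_intror uw)).
have [gD1 pD] := gD _ _ (gw t (or_introl erefl)) g1.
rewrite /pairing big_cons /delta /=; case: asboolP => _.
  by split=> //; rewrite pD IH1 mulr1.
by split=> //; rewrite IH1 mulr0 add0r.
Qed.

End Pairing.

Lemma eq_big_In (V : nmodType) (T : Type) (s : seq T) (F G : T -> V) :
  (forall t, List.In t s -> F t = G t) -> \sum_(t <- s) F t = \sum_(t <- s) G t.
Proof.
elim: s => [|t s IH] H; first by rewrite !big_nil.
by rewrite !big_cons H ?IH //; [move=> u us; apply: H; right|left].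
Qed.

Lemma In_filter (T : Type) (c : pred T) s t : List.In t (seq.filter c s) -> c t /\ List.In t s.
Proof.
elim: s => //= u s IH; case: ifP => [cu [<-|/IH[? ?]]|_ /IH[? ?]]; first by split=> //; left.
  by split=> //; right.
by split=> //; right.
Qed.

Lemma In_map (T S : Type) (h : T -> S) s y :
  List.In y [seq h t | t <- s] -> exists t, h t = y /\ List.In t s.
Proof.
elim: s => //= t s IH [<-|/IH[u [? ?]]]; first by exists t; split=> //; left.
by exists u; split=> //; right.
Qed.

(** Removing the class of the first symbol, whose total coefficient is 0, leaves a shorter sum with
    the same property. Transitivity is asked only through a middle term in [mem], since equality of
    fractions is transitive only when the middle denominator can be cancelled. *)
Lemma grouping (R : realType) (T : Type) (mem : T -> Prop) (eqv : T -> T -> Prop)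
    (s : seq (R * T)) (tau : T -> R) :
  (forall t, mem t -> eqv t t) -> (forall t u, eqv t u -> eqv u t) ->
  (forall t u v, mem u -> eqv t u -> eqv u v -> eqv t v) ->
  (forall t u, mem t -> mem u -> eqv t u -> tau t = tau u) ->
  (forall p, List.In p s -> mem p.2) ->
  (forall t, mem t -> \sum_(p <- s) p.1 * (if `[< eqv p.2 t >] then 1 else 0) = 0) ->
  \sum_(p <- s) p.1 * tau p.2 = 0.
Proof.
move=> eqv_refl eqv_sym eqv_trans tauE.
elim: {s}(size s) {-2}s (leqnn (size s)) => [|m IH] s sm smem s0.
  by case: s sm smem s0 => // *; rewrite big_nil.
case: s sm smem s0 => [|p s] sm smem s0; first by rewrite big_nil.
have tp : mem p.2 by apply: smem; left.
pose c (q : R * T) := `[< eqv q.2 p.2 >].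
have cp : c p by apply/asboolP/eqv_refl.
rewrite (bigID c) /= -(big_filter _ (predC c)) IH ?addr0.
- rewrite big_mkcond /=; transitivity
    (\sum_(q <- p :: s) q.1 * (if `[< eqv q.2 p.2 >] then 1 else 0) * tau p.2).
    apply: eq_big_In => q qs; rewrite /c; case: asboolP => [e|_]; last by rewrite mulr0 mul0r.
    by rewrite mulr1 (tauE _ _ _ _ e) //; exact: smem.
  by rewrite -mulr_suml s0 ?mul0r.
- rewrite -ltnS; apply: leq_trans sm; rewrite /= cp /= ltnS.
  by rewrite size_filter count_size.
- by move=> q qf; have [_ qs] := In_filter qf; exact: smem.
- move=> t tmem; have [pt|pt] := pselect (eqv p.2 t).
    rewrite (eq_big_In (G := fun=> 0)) ?big1 // => q qf.
    have [/= /asboolP qp qs] := In_filter qf.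
    case: asboolP => [qt|_]; last by rewrite mulr0.
    by case: qp; apply: (eqv_trans _ t) => //; exact: eqv_sym.
  rewrite big_filter big_mkcond /= -[RHS](s0 t tmem); apply: eq_big_In => q qs /=.
  rewrite /c; case: asboolP => //= qp; case: asboolP => qt; last by rewrite mulr0.
  by case: pt; apply: (eqv_trans _ q.2) => //; [exact: smem|exact: eqv_sym].
Qed.

(** * Relations between differentials of smooth functions *)

Section KahlerSmooth.
Context {R : realType} {n : nat}.
Local Notation Rn := 'rV[R]_n.
Local Notation mp := (mpoly.mpoly n R).
Local Notation "p @[ x ]" := (mpoly.meval (fun i => (x : Rn) ord0 i) p)
  (at level 2, x at level 200, format "p @[ x ]").
Context (U : set Rn) (oU : open U).
Local Notation E := (E_alg U).
Implicit Types (f g h k u v : Rn -> R) (p : mp) (P : {poly mp}) (w : fsum E).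

(* A formal sum is known in [Omega_E] through the coefficients of its symbols;
   [dsym h] is the coefficient function of the symbol [d h]. *)
Definition dsym h (h0 : Rn -> R) : R := delta (A := E) h0 h.

Definition coefs w (h0 : Rn -> R) (x : Rn) : R :=
  pairing (A := E) (fun a => a x) (delta (A := E) h0) w.

Lemma fs_coefE w h0 x : fs_coef w h0 x = coefs w h0 x.
Proof. by have [] := @fs_coef_pairing R E (fun a => a x) (fun=> True) w h0. Qed.

(** Being zero in the module of differentials, for an element given by its coefficient functions:
    lists occur only in the certificate, and elements can be combined by real arithmetic. *)
Definition kzero (V : (Rn -> R) -> Rn -> R) := exists rs : seq ((Rn -> R) * kgen (Rn -> R)),
  (forall r, Stdlib.Lists.List.In r rs -> smooth_on U r.1 /\ kgen_mem (A := E) r.2) /\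
  forall h0, smooth_on U h0 -> forall x, U x ->
    V h0 x = \sum_(r <- rs) r.1 x * coefs (kgen_elem (A := E) r.2) h0 x.

Lemma coefs_sub_relations w (rs : seq ((Rn -> R) * kgen (Rn -> R))) h0 x :
  coefs (fs_sub w (fs_sum [seq fs_scale (A := E) r.1 (kgen_elem (A := E) r.2) | r <- rs])) h0 x =
  coefs w h0 x - \sum_(r <- rs) r.1 x * coefs (kgen_elem (A := E) r.2) h0 x.
Proof.
rewrite /coefs pairing_sub // pairing_sum; congr (_ - _).
by apply: eq_bigr => r _; rewrite pairing_scale.
Qed.

Lemma kahler_zeroE w : kahler_zero w <-> kzero (coefs w).
Proof.
split=> -[rs [Hrs H]]; exists rs; split=> // h0 sh0.
  move=> x Ux; have := H h0 sh0 x Ux.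
  by rewrite fs_coefE coefs_sub_relations => /eqP; rewrite subr_eq0 => /eqP.
by move=> x Ux; rewrite fs_coefE coefs_sub_relations H // subrr.
Qed.

Lemma kzero_ext V W : (forall h0 x, U x -> V h0 x = W h0 x) -> kzero V -> kzero W.
Proof.
move=> VW [rs [Hrs H]]; exists rs; split=> // h0 sh0 x Ux.
by rewrite -(VW _ _ Ux) H.
Qed.

Lemma kzeroD V W : kzero V -> kzero W -> kzero (fun h0 x => V h0 x + W h0 x).
Proof.
move=> [rs [Hrs HV]] [ss [Hss HW]]; exists (rs ++ ss); split=> [r|h0 sh0 x Ux].
  by move=> H; case: (List.in_app_or _ _ _ H) => [/Hrs|/Hss].
by rewrite big_cat /= HV // HW.
Qed.

Lemma kzeroZ b V : smooth_on U b -> kzero V -> kzero (fun h0 x => b x * V h0 x).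
Proof.
move=> sb [rs [Hrs HV]]; exists [seq (fun x => b x * r.1 x, r.2) | r <- rs].
split=> [r|h0 sh0 x Ux].
  move=> H; have [s [<- /Hrs[s1 s2]]] := In_map H.
  by split; [exact: (smoothM oU sb s1)|exact: s2].
by rewrite HV // mulr_sumr big_map; apply: eq_bigr => r _; rewrite mulrA.
Qed.

Lemma kzero_gen (e : kgen (Rn -> R)) :
  kgen_mem (A := E) e -> kzero (coefs (kgen_elem (A := E) e)).
Proof.
move=> eE; exists [:: (fun=> 1, e)]; split=> [r [<-|//]|h0 _ x _].
  by split=> //; exact: smooth_const.
by rewrite big_seq1 mul1r.
Qed.

Lemma kzero_add h k : smooth_on U h -> smooth_on U k ->
  kzero (fun h0 x => dsym (fun x => h x + k x) h0 - (dsym h h0 + dsym k h0)).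
Proof.
move=> sh sk; apply: kzero_ext (@kzero_gen (KAdd h k) (conj sh sk)) => h0 x _.
by rewrite /coefs pairing_kgen.
Qed.

Lemma kzero_mul h k : smooth_on U h -> smooth_on U k ->
  kzero (fun h0 x => dsym (fun x => h x * k x) h0 - (h x * dsym k h0 + k x * dsym h h0)).
Proof.
move=> sh sk; apply: kzero_ext (@kzero_gen (KMul h k) (conj sh sk)) => h0 x _.
by rewrite /coefs pairing_kgen.
Qed.

Lemma kzero_scal c h : smooth_on U h ->
  kzero (fun h0 x => dsym (fun x => c * h x) h0 - c * dsym h h0).
Proof.
move=> sh; apply: kzero_ext (@kzero_gen (KScal c h) sh) => h0 x _.
by rewrite /coefs pairing_kgen.
Qed.

Lemma dsym_ext h k : (forall x, U x -> h x = k x) -> dsym h = dsym k.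
Proof.
move=> hk; apply/funext => h0; rewrite /dsym /delta; congr (if _ then _ else _).
by apply/asbool_equiv_eq; split=> H x Ux; [rewrite -hk|rewrite hk] => //; exact: H.
Qed.

Lemma kzero_const c : kzero (fun h0 _ => dsym (fun=> c) h0).
Proof.
have s1 := @smooth_const R n U 1 oU.
have k1 : kzero (fun h0 _ => dsym (fun=> 1) h0).
  (* The Leibniz relation for [1 * 1] has coefficients of [d 1 - 2 d 1]; the factor -1 gives
     [d 1]. *)
  apply: kzero_ext (kzeroZ (@smooth_const R n U (-1) oU) (kzero_mul s1 s1)) => h0 x _ /=.
  under [X in dsym X]eq_fun do rewrite mulr1.
  ring.
apply: kzero_ext (kzeroD (kzero_scal c s1) (kzeroZ (@smooth_const R n U c oU) k1)) => h0 x _ /=.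
rewrite (@dsym_ext (fun=> c * 1) (fun=> c)) => [|y _]; last by rewrite mulr1.
ring.
Qed.

Definition omega h (h0 : Rn -> R) (x : Rn) : R :=
  dsym h h0 - \sum_i partial i h x * dsym (xcoord i) h0.

(** States [omega h = u * omega f] modulo relations. Carrying the multiplier [u] makes the property
    inductive over polynomial expressions in the coordinates and [f], where [u] is the formal
    derivative in the last variable. *)
Definition omega_mult f h u := kzero (fun h0 x => omega h h0 x - u x * omega f h0 x).

Section OmegaMult.
Context (f : Rn -> R) (sf : smooth_on U f).

Lemma omega_multD h k u v : smooth_on U h -> smooth_on U k ->
  omega_mult f h u -> omega_mult f k v ->
  omega_mult f (fun x => h x + k x) (fun x => u x + v x).
Proof.
move=> sh sk Hh Hk; apply: kzero_ext (kzeroD (kzero_add sh sk) (kzeroD Hh Hk)) => h0 x Ux.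
rewrite /omega.
have -> : \sum_i partial i (fun x => h x + k x) x * dsym (xcoord i) h0 =
    \sum_i partial i h x * dsym (xcoord i) h0 + \sum_i partial i k x * dsym (xcoord i) h0.
  rewrite -big_split /=; apply: eq_bigr => i _; rewrite partialD ?mulrDl //.
    exact: smooth_derivable sh Ux.
  exact: smooth_derivable sk Ux.
ring.
Qed.

Lemma omega_multM h k u v : smooth_on U h -> smooth_on U k ->
  omega_mult f h u -> omega_mult f k v ->
  omega_mult f (fun x => h x * k x) (fun x => u x * k x + h x * v x).
Proof.
move=> sh sk Hh Hk.
apply: kzero_ext (kzeroD (kzero_mul sh sk) (kzeroD (kzeroZ sk Hh) (kzeroZ sh Hk))) => h0 x Ux.
rewrite /omega.
have -> : \sum_i partial i (fun x => h x * k x) x * dsym (xcoord i) h0 =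
    k x * (\sum_i partial i h x * dsym (xcoord i) h0) +
    h x * (\sum_i partial i k x * dsym (xcoord i) h0).
  rewrite !mulr_sumr -big_split /=; apply: eq_bigr => i _; rewrite partialM.
  - ring.
  - exact: smooth_derivable sh Ux.
  - exact: smooth_derivable sk Ux.
ring.
Qed.

Lemma omega_mult_const c : omega_mult f (fun=> c) (fun=> 0).
Proof.
apply: kzero_ext (kzero_const c) => h0 x Ux; rewrite /omega mul0r subr0 big1 ?subr0 // => i _.
by rewrite /partial derive_cst mul0r.
Qed.

Lemma partial_coord i j x : partial i (xcoord j : Rn -> R) x = (i == j)%:R.
Proof.
have H (s : R) : `|s| < 1 ->
    `|xcoord j (x + s *: ('e_i : Rn)) - xcoord j x - s * (i == j)%:R| <= 0 * s ^+ 2.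
  move=> _; rewrite /xcoord !mxE eqxx /= mul0r eq_sym.
  by rewrite [X in Num.norm X](_ : _ = 0) ?normr0 //; ring.
by have [_] := quad_derive ltr01 H.
Qed.

Lemma omega_mult_coord j : omega_mult f (xcoord j) (fun=> 0).
Proof.
apply: kzero_ext (kzeroZ (@smooth_const R n U 0 oU) (kzero_const 0)) => h0 x Ux.
rewrite /omega !mul0r subr0 (bigD1 j) //= partial_coord eqxx mul1r.
rewrite big1 ?addr0 ?subrr // => i ij.
by rewrite partial_coord (negbTE ij) mul0r.
Qed.

Lemma omega_mult_self : omega_mult f f (fun=> 1).
Proof.
apply: kzero_ext (kzeroZ (@smooth_const R n U 0 oU) (kzero_const 0)) => h0 x Ux.
by rewrite mul0r mul1r subrr.
Qed.

Lemma smooth_meval p : smooth_on U (fun x => p@[x]).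
Proof.
apply: (@meval_closed _ _ (smooth_on U)) => [c|i|h k|h k].
- exact: smooth_const.
- exact: smooth_coord.
- exact: smoothD.
- exact: smoothM.
Qed.

Lemma smooth_pevl P : smooth_on U (pevl P f).
Proof.
apply: (@pevl_closed _ _ (smooth_on U)) => [c|i|h k|h k|].
- exact: smooth_const.
- exact: smooth_coord.
- exact: smoothD.
- exact: smoothM.
- exact: sf.
Qed.

Lemma omega_mult_meval p : omega_mult f (fun x => p@[x]) (fun=> 0).
Proof.
suff [] : smooth_on U (fun x => p@[x]) /\ omega_mult f (fun x => p@[x]) (fun=> 0) by [].
apply: (@meval_closed _ _ (fun h => smooth_on U h /\ omega_mult f h (fun=> 0))).
- by move=> c; split; [exact: smooth_const|exact: omega_mult_const].
- by move=> i; split; [exact: smooth_coord|exact: omega_mult_coord].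
- move=> h k [sh Hh] [sk Hk]; split; first exact: smoothD.
  by have := omega_multD sh sk Hh Hk; under [X in omega_mult _ _ X]eq_fun do rewrite addr0.
- move=> h k [sh Hh] [sk Hk]; split; first exact: smoothM.
  have := omega_multM sh sk Hh Hk.
  by under [X in omega_mult _ _ X]eq_fun do rewrite mulr0 mul0r addr0.
Qed.

Lemma omega_mult_pevl P : omega_mult f (pevl P f) (pevl P^`() f).
Proof.
elim/poly_ind: P => [|P p IH]; first by rewrite deriv0 pevl0; exact: omega_mult_const.
have := omega_multD (smoothM oU (smooth_pevl P) sf) (smooth_meval p)
  (omega_multM (smooth_pevl P) sf IH omega_mult_self) (omega_mult_meval p).
rewrite pevlMX derivD derivM derivX mulr1 derivC addr0; congr (omega_mult _ _ _).
by apply/funext => x; rewrite addr0 mulr1 /pevl rmorphD rmorphM /= map_polyX !hornerE.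
Qed.

Lemma algebraic_omega P : (forall x, U x -> pevl P f x = 0) ->
  kzero (fun h0 x => pevl P^`() f x * omega f h0 x).
Proof.
move=> HP.
have H0 : kzero (omega (pevl P f)).
  apply: kzero_ext (kzero_const 0) => h0 x Ux; rewrite /omega (dsym_ext HP).
  rewrite big1 ?subr0 // => i _.
  by rewrite (eq_on_partial i oU HP Ux) /partial derive_cst mul0r.
have := kzeroD H0 (kzeroZ (@smooth_const R n U (-1) oU) (omega_mult_pevl P)).
by apply: kzero_ext => h0 x _; ring.
Qed.

End OmegaMult.

Lemma coefs_omega f g h0 x :
  coefs (fs_scale (A := E) g (fs_sub (A := E) (fs_d (A := E) f)
    (fs_sum [seq fs_scale (A := E) (partial i f) (fs_d (A := E) (xcoord i)) | i <- enum 'I_n]))) h0 x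
  = g x * omega f h0 x.
Proof.
rewrite /coefs pairing_scale // pairing_sub // pairing_d // pairing_sum big_enum /omega.
by congr (_ * (_ - _)); apply: eq_bigr => i _; rewrite pairing_scale // pairing_d.
Qed.

Lemma mp_mulrn_eq0 p (m : nat) : p *+ m.+1 = 0 -> p = 0.
Proof.
move=> pk; apply: meval_all_zero => x.
have := congr1 (mpoly.meval (fun i => x ord0 i)) pk.
by rewrite rmorphMn rmorph0 /= => /eqP; rewrite mulrn_eq0 => /eqP.
Qed.

Lemma nash_omega f : U !=set0 -> nash_on U f -> exists g, nash_S U g /\
  kzero (fun h0 x => g x * omega f h0 x).
Proof.
move=> U0 nf; have [af [P0 P00 HP0]] := nf.
pose alg (m : nat) :=
  `[< exists P : {poly mp}, [/\ P != 0, size P = m & forall x, U x -> pevl P f x = 0] >].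
have ex : exists m, alg m by exists (size P0); apply/asboolP; exists P0.
have [m /asboolP[P [Pn0 sP HP]] min] := ex_minnP ex.
have sf : smooth_on U f by exact: analytic_smooth.
exists (pevl P^`() f); split; last exact: algebraic_omega.
split; first exact: nash_pevl.
apply: contrapT => H.
have HP' x : U x -> pevl P^`() f x = 0.
  by move=> Ux; apply/eqP/negPn/negP => ne; apply: H; exists x.
(* With zero derivative [P] would be constant in y, hence a polynomial in x vanishing on a nonempty
   open set, hence 0. *)
have P'0 : P^`() != 0.
  apply/eqP => P'0; have Pc : P = (P`_0)%:P.
    apply/polyP => -[|i]; rewrite coefC //=.
    by apply: (@mp_mulrn_eq0 _ i); rewrite -coef_deriv P'0 coef0.
  have : P`_0 = 0.
    apply: (@meval_zero R n U) => // x Ux.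
    by have := HP x Ux; rewrite Pc /pevl map_polyC hornerC coefC.
  by move=> c0; rewrite Pc c0 eqxx in Pn0.
have : alg (size P^`()) by apply/asboolP; exists P^`().
move=> /min; apply/negP; rewrite -ltnNge -sP.
exact: lt_size_deriv.
Qed.

End KahlerSmooth.

(** * Properties of the coefficients and symbols of a formal sum *)

Section FormalSumMembers.
Context {R : realType} {A : @setoid_alg R} (Q1 Q2 : sa_car A -> Prop)
  (Q1M : forall a b, Q1 a -> Q1 b -> Q1 (sa_mul A a b))
  (Q1N : forall a, Q1 a -> Q1 (sa_opp A a)) (Q11 : Q1 (sa_one A)).
Implicit Types (w : fsum A) (h : sa_car A).

Definition fs_all w := forall t, List.In t w -> Q1 t.1 /\ Q2 t.2.

Lemma fs_all_add w1 w2 : fs_all w1 -> fs_all w2 -> fs_all (fs_add w1 w2).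
Proof. by move=> H1 H2 t tw; case: (List.in_app_or _ _ _ tw) => [/H1|/H2]. Qed.

Lemma fs_all_scale b w : Q1 b -> fs_all w -> fs_all (fs_scale b w).
Proof.
move=> Qb H t tw; have [u [<- /H[? ?]]] := In_map tw.
by split=> //; exact: Q1M.
Qed.

Lemma fs_all_sub w1 w2 : fs_all w1 -> fs_all w2 -> fs_all (fs_sub w1 w2).
Proof. by move=> H1 H2; apply: fs_all_add => //; apply: fs_all_scale => //; exact: Q1N. Qed.

Lemma fs_all_d h : Q2 h -> fs_all (fs_d h).
Proof. by move=> Qh t [<-|[]]. Qed.

Lemma fs_all_sum (I : Type) (r : seq I) (F : I -> fsum A) :
  (forall i, List.In i r -> fs_all (F i)) -> fs_all (fs_sum [seq F i | i <- r]).
Proof.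
elim: r => [|i r IH] H; first by move=> t [].
apply: fs_all_add; first by apply: H; left.
by apply: IH => j jr; apply: H; right.
Qed.

Lemma fs_all_kgen (e : kgen (sa_car A)) :
  (forall c, Q1 (sa_scal A c (sa_one A))) -> (forall a, sa_mem A a -> Q1 a) ->
  (forall h k, sa_mem A h -> sa_mem A k -> [/\ Q2 h, Q2 (sa_add A h k) & Q2 (sa_mul A h k)]) ->
  (forall c h, sa_mem A h -> Q2 (sa_scal A c h)) ->
  kgen_mem e -> fs_all (kgen_elem e).
Proof.
move=> Q1Z Q1m Q2D Q2Z; case: e => [h k|c h|h k]; rewrite /kgen_mem /kgen_elem.
- move=> [mh mk]; have [Qh Qhk _] := Q2D h k mh mk; have [Qk _ _] := Q2D k h mk mh.
  apply: fs_all_sub; [exact: fs_all_d|]; by apply: fs_all_add; exact: fs_all_d.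
- move=> mh; have [Qh _ _] := Q2D h h mh mh.
  by apply: fs_all_sub; [exact/fs_all_d/Q2Z|apply: fs_all_scale => //; exact: fs_all_d].
- move=> [mh mk]; have [Qh _ Qhk] := Q2D h k mh mk; have [Qk _ _] := Q2D k h mk mh.
  apply: fs_all_sub; first exact: fs_all_d.
  by apply: fs_all_add; apply: fs_all_scale; (try exact: Q1m); exact: fs_all_d.
Qed.

Lemma fs_all_linear (I : Type) (r : seq I) h (a x : I -> sa_car A) :
  Q2 h -> (forall i, Q1 (a i)) -> (forall i, Q2 (x i)) ->
  fs_all (fs_sub (fs_d h) (fs_sum [seq fs_scale (a i) (fs_d (x i)) | i <- r])).
Proof.
move=> Qh Qa Qx; apply: fs_all_sub; first exact: fs_all_d.
by apply: fs_all_sum => i _; apply: fs_all_scale; [exact: Qa|exact: fs_all_d].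
Qed.

Lemma fs_all_relations w (rs : seq (sa_car A * kgen (sa_car A))) : fs_all w ->
  (forall r, List.In r rs -> Q1 r.1 /\ fs_all (kgen_elem r.2)) ->
  fs_all (fs_sub w (fs_sum [seq fs_scale r.1 (kgen_elem r.2) | r <- rs])).
Proof.
move=> Qw Qrs; apply: fs_all_sub => //; apply: fs_all_sum => r /Qrs[? ?].
exact: fs_all_scale.
Qed.

End FormalSumMembers.

(** * Passage to the localization *)

Section Localization.
Context {R : realType} {n : nat}.
Local Notation Rn := 'rV[R]_n.
Context (U : set Rn) (oU : open U) (cU : connected U) (U0 : U !=set0).
Local Notation E := (E_alg U).
Local Notation Et := (Et_alg U).
Implicit Types (f g h k : Rn -> R) (p q : sa_car Et).

Lemma nash_S_one : nash_S U (fun=> 1).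
Proof.
have [u Uu] := U0; split; first exact: nash_const.
by exists u; split=> //; exact: oner_neq0.
Qed.

(** By the identity theorem [h] cannot vanish on all of [V]. The form relative to [V] lets several
    such functions be treated by nesting one open set in another. *)
Lemma analytic_nonzero_open V h : analytic_on U h -> (exists x, U x /\ h x != 0) ->
  open V -> V `<=` U -> V !=set0 ->
  exists W, [/\ open W, W `<=` V, W !=set0 & forall x, W x -> h x != 0].
Proof.
move=> ah [x0 [Ux0 hx0]] oV VU V0.
have [[x [Vx hx]]|H] := pselect (exists x, V x /\ h x != 0); last first.
  case/eqP: hx0; apply: (analytic_identity cU oU ah oV VU V0) Ux0 => x Vx.
  by apply: contrapT => /eqP hx; apply: H; exists x.
have ch : {for x, continuous h}.
  exact: smooth_continuous (analytic_smooth oU ah) (VU _ Vx).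
have : nbhs x [set y | h y != 0].
  by apply: (ch [set u | u != 0]); apply: open_nbhs_nbhs; split=> //; exact: open_neq.
move=> /(filterI (open_nbhs_nbhs (conj oV Vx))).
rewrite nbhsE => -[W [oW Wx] WV]; exists W; split=> //.
- by move=> y /WV[].
- by exists x.
- by move=> y /WV[].
Qed.

Lemma nash_S_mul s t : nash_S U s -> nash_S U t -> nash_S U (fun x => s x * t x).
Proof.
move=> Ss St; split; first exact: nashM Ss.1 St.1.
have [W1 [oW1 W1U W10 HW1]] := analytic_nonzero_open Ss.1.1 Ss.2 oU (@subset_refl _ U) U0.
have [W2 [oW2 W2W1 [x W2x] HW2]] := analytic_nonzero_open St.1.1 St.2 oW1 W1U W10.
by exists x; split; [exact/W1U/W2W1|rewrite mulf_neq0 ?HW2 // HW1 //; exact: W2W1].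
Qed.

Lemma nash_S_smooth s : nash_S U s -> smooth_on U s.
Proof. by move=> [[as_ _] _]; exact: analytic_smooth. Qed.

Lemma Et_memD p q : sa_mem Et p -> sa_mem Et q -> sa_mem Et (sa_add Et p q).
Proof.
move=> [sp Sp] [sq Sq]; split; last exact: nash_S_mul Sp Sq.
exact: smoothD oU (smoothM oU sp (nash_S_smooth Sq)) (smoothM oU sq (nash_S_smooth Sp)).
Qed.

Lemma Et_memM p q : sa_mem Et p -> sa_mem Et q -> sa_mem Et (sa_mul Et p q).
Proof.
by move=> [sp Sp] [sq Sq]; split; [exact: (smoothM oU sp sq)|exact: (nash_S_mul Sp Sq)].
Qed.

Lemma Et_memZ c p : sa_mem Et p -> sa_mem Et (sa_scal Et c p).
Proof.
by move=> [sp Sp]; split; [exact: (smoothM oU (smooth_const c oU) sp)|exact: Sp].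
Qed.

Lemma to_Et_mem h : smooth_on U h -> sa_mem Et (to_Et U h).
Proof. by move=> sh; split; [exact: sh|exact: nash_S_one]. Qed.

(** Since division by 0 gives 0, evaluation is multiplicative at every point, but additive only
    where both denominators are nonzero. *)
Definition fval (x : Rn) p : R := p.1 x / p.2 x.

Lemma fvalM x p q : fval x (sa_mul Et p q) = fval x p * fval x q.
Proof. by rewrite /fval /= invfM mulrACA. Qed.

Lemma fvalN x p : fval x (sa_opp Et p) = - fval x p.
Proof. by rewrite /fval /= mulNr. Qed.

Lemma fval1 x : fval x (sa_one Et) = 1.
Proof. by rewrite /fval /= divr1. Qed.

Lemma fvalZ x c p : fval x (sa_scal Et c p) = c * fval x p.
Proof. by rewrite /fval /= mulrA. Qed.

Lemma fval_to_Et x h : fval x (to_Et U h) = h x.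
Proof. by rewrite /fval /= divr1. Qed.

Lemma fval_fs_coef x (w : fsum Et) (q : sa_car Et) :
  (forall u, List.In u w -> u.1.2 x != 0) ->
  (fs_coef w q).2 x != 0 /\ fval x (fs_coef w q) = pairing (fval x) (delta q) w.
Proof.
apply: (@fs_coef_pairing _ Et (fval x) (fun p => p.2 x != 0)).
- exact: oner_neq0.
- by rewrite /fval /= mul0r.
- move=> p r p0 r0; split; first exact: mulf_neq0.
  by rewrite /fval /= addf_div.
Qed.

Definition kgen_Et (e : @kgen R (Rn -> R)) : @kgen R (sa_car Et) :=
  match e with
  | KAdd h k => KAdd (to_Et U h) (to_Et U k)
  | KScal c h => KScal c (to_Et U h)
  | KMul h k => KMul (to_Et U h) (to_Et U k)
  end.

Lemma kgen_Et_mem e : kgen_mem (A := E) e -> kgen_mem (kgen_Et e).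
Proof.
by case: e => [h k|c h|h k] /=; [move=> [? ?]; split|move=> ?|move=> [? ?]; split];
  exact: to_Et_mem.
Qed.

Lemma pairing_kgen_Et x (tau : sa_car Et -> R) (e : kgen (Rn -> R)) :
  pairing (fval x) tau (kgen_elem (kgen_Et e)) =
  pairing (A := E) (fun a => a x) (tau \o to_Et U) (kgen_elem (A := E) e).
Proof.
rewrite !pairing_kgen //; first last.
- exact: fvalZ.
- exact: fval1.
- exact: fvalN.
- exact: fvalM.
(* Sums and products of fractions over 1 have denominator [1 * 1], equal to 1 only by function
   extensionality. *)
have one : (fun=> 1 * 1) = (fun=> 1) :> (Rn -> R) by apply/funext => y; rewrite mulr1.
case: e => [h k|c h|h k] /=; rewrite ?fval_to_Et //.
- rewrite /to_Et one; congr (tau (_, _) - _).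
  by apply/funext => y; rewrite !mulr1.
- by rewrite /to_Et one.
Qed.

Lemma E_pairing_zero (w : fsum E) (tau : (Rn -> R) -> R) x : U x ->
  (forall u, List.In u w -> smooth_on U u.2) -> free_zero w ->
  (forall h k, (forall y, U y -> h y = k y) -> tau h = tau k) ->
  pairing (A := E) (fun a => a x) tau w = 0.
Proof.
move=> Ux sw w0 tauE.
have := @grouping R (Rn -> R) (smooth_on U) (fun h k => forall y, U y -> h y = k y)
  [seq (t.1 x, t.2) | t <- w] tau.
rewrite big_map; apply.
- by [].
- by move=> h k hk y Uy; rewrite hk.
- by move=> h k l _ hk kl y Uy; rewrite hk // kl.
- by move=> h k _ _; exact: tauE.
- by move=> p pw; have [t [<- /sw]] := In_map pw.
- by move=> h sh; rewrite big_map; have := w0 h sh x Ux; rewrite fs_coefE.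
Qed.

(** The given relations, with their coefficients divided by [g], certify the new identity. Reading
    off the coefficient of [h0] is a functional on the original formal sums, constant on functions
    that agree on [U]. *)
Lemma localize_kahler f g : smooth_on U f -> nash_S U g ->
  kahler_zero (fs_scale (A := E) g (fs_sub (A := E) (fs_d (A := E) f)
    (fs_sum [seq fs_scale (A := E) (partial i f) (fs_d (A := E) (xcoord i)) | i <- enum 'I_n]))) ->
  kahler_eq (fs_d (to_Et U f))
    (fs_sum [seq fs_scale (to_Et U (partial i f)) (fs_d (to_Et U (xcoord i))) | i <- enum 'I_n]).
Proof.
move=> sf Sg [rs [rsE w0]].
exists [seq ((r.1, g) : sa_car Et, kgen_Et r.2) | r <- rs]; split.
  move=> r' rr; have [r [<- /rsE[sr kr]]] := In_map rr.
  by split; [split|exact: kgen_Et_mem].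
move=> h0 mh0; set w := (X in fs_coef X _); set c := fs_coef w h0.
(* The multiplier g takes care of the zeros of g, where fval is junk. *)
exists g; split=> // x Ux; have [->|gx] := eqVneq (g x) 0; first by rewrite mul0r.
pose good p := p.2 x != 0.
have goodM p q : good p -> good q -> good (sa_mul Et p q) by exact: mulf_neq0.
have goodN p : good p -> good (sa_opp Et p) by [].
have good1 : good (sa_one Et) by exact: oner_neq0.
have [c2 cE] : c.2 x != 0 /\ fval x c = pairing (fval x) (delta h0) w.
  apply: fval_fs_coef => t tw; suff [] : good t.1 /\ True by [].
  move: t tw; apply: (@fs_all_sub _ Et good (fun=> True)) => //.
    apply: fs_all_sub => //; first exact: fs_all_d.
    by apply: fs_all_sum => i _; apply: fs_all_scale => //; exact: fs_all_d.
  rewrite -map_comp; apply: fs_all_sum => r _; apply: fs_all_scale => //.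
  have goodE h : good (to_Et U h) by exact: oner_neq0.
  case: r.2 => [h k|l h|h k]; apply: fs_all_sub => //; do ?[exact: fs_all_d|
    apply: fs_all_add|by apply: fs_all_scale => //; exact: fs_all_d].
pose tau h := delta h0 (to_Et U h).
have tauE h k : (forall y, U y -> h y = k y) -> tau h = tau k.
  move=> hk; rewrite /tau /delta; congr (if _ then _ else _); apply/asbool_equiv_eq.
  by split=> -[t [St Ht]]; exists t; split=> // y Uy; have := Ht y Uy; rewrite /= hk.
suff c0 : fval x c = 0.
  move: c0; rewrite /fval => /eqP; rewrite mulf_eq0 invr_eq0 (negbTE c2) orbF => /eqP c10.
  by rewrite c10 !mul0r subrr mulr0.
have M := @fvalM x; have N := @fvalN x; have F1 := fval1 x; have Z := @fvalZ x.
rewrite cE /w pairing_sub // pairing_sub // pairing_d // !pairing_sum.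
set S1 := \sum_(i <- enum 'I_n) _.
have S1E : S1 = \sum_(i <- enum 'I_n) partial i f x * tau (xcoord i).
  by apply: eq_bigr => i _; rewrite pairing_scale // pairing_d // fval_to_Et.
have -> : \sum_(r <- [seq (r.1, g, kgen_Et r.2) | r <- rs])
    pairing (fval x) (delta h0) (fs_scale (A := Et) r.1 (kgen_elem r.2)) =
  (g x)^-1 * \sum_(r <- rs) r.1 x * pairing (A := E) (@^~ x) tau (kgen_elem (A := E) r.2).
  rewrite big_map mulr_sumr; apply: eq_bigr => r _.
  by rewrite pairing_scale // pairing_kgen_Et /fval /= mulrA [_ * r.1 x]mulrC.
have := @E_pairing_zero _ tau x Ux _ w0 tauE.
rewrite pairing_sub // pairing_scale // pairing_sub // pairing_d // !pairing_sum.
rewrite S1E; set S2 := \sum_(i <- rs) _.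
have -> : S2 = \sum_(r <- rs) r.1 x * pairing (A := E) (@^~ x) tau (kgen_elem (A := E) r.2).
  by apply: eq_bigr => r _; rewrite pairing_scale.
have -> : \sum_(i <- enum 'I_n) pairing (A := E) (@^~ x) tau
    (fs_scale (A := E) (partial i f) (fs_d (A := E) (xcoord i))) =
    \sum_(i <- enum 'I_n) partial i f x * tau (xcoord i).
  by apply: eq_bigr => i _; rewrite pairing_scale // pairing_d.
move=> H; apply: (mulfI gx); rewrite mulr0 mulrBr mulVKf //; apply: H.
have sx i : smooth_on U (xcoord i) by exact: smooth_coord.
pose TM (_ _ : Rn -> R) (_ _ : True) := I; pose TN (_ : Rn -> R) (_ : True) := I.
have : fs_all (A := E) (fun=> True) (smooth_on U) (fs_sub (A := E) (fs_scale (A := E) g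
    (fs_sub (A := E) (fs_d (A := E) f)
    (fs_sum [seq fs_scale (A := E) (partial i f) (fs_d (A := E) (xcoord i)) | i <- enum 'I_n])))
    (fs_sum [seq fs_scale (A := E) r.1 (kgen_elem (A := E) r.2) | r <- rs])).
  apply: (@fs_all_relations _ E (fun=> True) (smooth_on U) TM TN I).
    apply: (@fs_all_scale _ E (fun=> True) (smooth_on U) TM _ _ I).
    exact: (@fs_all_linear _ E (fun=> True) (smooth_on U) TM TN I _ _ _ _ _ sf (fun=> I) sx).
  move=> r /rsE[_ kr]; split; first exact: I.
  apply: (@fs_all_kgen _ E (fun=> True) (smooth_on U) TM TN I _ _ _ _ _ kr) => [c'|a _|h k sh sk|l h sh]; [exact: I|exact: I| |].
    by split; [exact: sh|exact: (smoothD oU sh sk)|exact: (smoothM oU sh sk)].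
  exact: (smoothM oU (smooth_const l oU) sh).
by move=> H u /H[].
Qed.

End Localization.

(** * Derivations modulo an ultrafilter *)

Section Derivations.
Context {R : realType} {X : Type} (G : set_system X) {UG : UltraFilter G}.
Local Notation "'ae' x , P" := (G (fun x => P)) (at level 200, x name, P at level 200).

(** Maximality of [G] makes the values behave like a field: what is not almost everywhere zero is
    almost everywhere nonzero. *)
Lemma ultra_or (P : X -> Prop) : (ae x, P x) \/ (ae x, ~ P x).
Proof. exact: (in_ultra_setVsetC (fun x => P x)). Qed.

Lemma aeS (P Q : X -> Prop) : (forall x, P x -> Q x) -> (ae x, P x) -> ae x, Q x.
Proof. by move=> PQ; apply: filterS. Qed.

Lemma aeS2 (P Q S : X -> Prop) : (forall x, P x -> Q x -> S x) ->
  (ae x, P x) -> (ae x, Q x) -> ae x, S x.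
Proof. by move=> PQS FP FQ; apply: filterS2 PQS FP FQ. Qed.

Lemma aeI (P Q : X -> Prop) : (ae x, P x) -> (ae x, Q x) -> ae x, (P x /\ Q x).
Proof. exact: filterI. Qed.

Lemma ae_all_lt (m : nat) (P : nat -> X -> Prop) :
  (forall i, ae x, P i x) -> ae x, (forall i, (i < m)%N -> P i x).
Proof.
move=> HP; elim: m => [|m IH]; first exact: filterE.
apply: (aeS2 _ IH (HP m)) => x H1 H2 i.
by rewrite ltnS leq_eqVlt => /predU1P[->|/H1].
Qed.

(* The ring A stands for its image in the ultrapower of R along G: iota is the
   evaluation map, and dersys_ker says that D factors through the image. *)
Record dersys (A : comNzRingType) (iota : X -> {rmorphism A -> R}) (D : X -> A -> R) : Prop :=
  DerSys {
    dersysD : forall x a b, D x (a + b) = D x a + D x b;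
    dersysM : forall x a b, D x (a * b) = iota x a * D x b + iota x b * D x a;
    dersys_ker : forall a, (ae x, iota x a = 0) -> ae x, D x a = 0 }.

Section Extension.
Context (A : comNzRingType) (iota : X -> {rmorphism A -> R}) (D : X -> A -> R)
  (HA : dersys iota D) (z : X -> R).
Implicit Types (p q r : {poly A}).

Lemma dersys0 x : D x 0 = 0.
Proof. by apply: (addrI (D x 0)); rewrite -(dersysD HA) !addr0. Qed.

Definition ev_iota x p : R := (map_poly (iota x) p).[z x].
Definition ev_D x p : R := (map_poly (D x) p).[z x].

Lemma coef_D x p i : (map_poly (D x) p)`_i = D x p`_i.
Proof. by rewrite coef_map_id0 // dersys0. Qed.

Lemma D_sum x (I : Type) (s : seq I) (F : I -> A) :
  D x (\sum_(i <- s) F i) = \sum_(i <- s) D x (F i).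
Proof.
elim: s => [|i s IH]; first by rewrite !big_nil dersys0.
by rewrite !big_cons (dersysD HA) IH.
Qed.

Lemma ev_DD x p q : ev_D x (p + q) = ev_D x p + ev_D x q.
Proof.
rewrite /ev_D -hornerD; congr (_.[_]); apply/polyP => i.
by rewrite coefD !coef_D coefD (dersysD HA).
Qed.

Lemma ev_DM x p q : ev_D x (p * q) = ev_iota x p * ev_D x q + ev_iota x q * ev_D x p.
Proof.
rewrite /ev_D /ev_iota -!hornerM -hornerD; congr (_.[_]); apply/polyP => i.
rewrite coefD coef_D [map_poly (iota x) q * _]mulrC !coefM D_sum -big_split /=.
apply: eq_bigr => j _; rewrite (dersysM HA) !coef_D !coef_map /=; congr (_ + _).
exact: mulrC.
Qed.

Definition ext_iota x : {rmorphism {poly A} -> R} :=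
  horner_eval (z x) \o map_poly (iota x).

(** The only possible value at [p(z)] of an extension sending [z] to [zeta]: [D] on the
    coefficients, plus p'(z) times [zeta]. *)
Definition ext_D (zeta : X -> R) x p : R := ev_D x p + ev_iota x p^`() * zeta x.

Lemma ext_DD zeta x p q : ext_D zeta x (p + q) = ext_D zeta x p + ext_D zeta x q.
Proof. by rewrite /ext_D ev_DD derivD /ev_iota rmorphD hornerD mulrDl addrACA. Qed.

Lemma ext_DM zeta x p q : ext_D zeta x (p * q) =
  ev_iota x p * ext_D zeta x q + ev_iota x q * ext_D zeta x p.
Proof.
rewrite /ext_D ev_DM derivM /ev_iota rmorphD !rmorphM hornerD !hornerM /=; ring.
Qed.

(** The zero polynomial over the image of [A] in the ultrapower. This is weaker than [p = 0],
    because evaluation may have a kernel. *)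
Definition null p := forall i, ae x, iota x p`_i = 0.

Lemma null_iota p : null p -> ae x, ev_iota x p = 0.
Proof.
move=> np; apply: (aeS _ (ae_all_lt (size p) np)) => x Hx.
rewrite /ev_iota (@horner_coef_wide _ (size p)) ?size_poly //.
by rewrite big1 // => i _; rewrite coef_map /= (Hx _ (ltn_ord i)) mul0r.
Qed.

Lemma null_D p : null p -> ae x, ev_D x p = 0.
Proof.
move=> np; apply: (aeS _ (ae_all_lt (size p) (fun i => dersys_ker HA (np i)))) => x Hx.
rewrite /ev_D (@horner_coef_wide _ (size p)) ?size_poly //.
by rewrite big1 // => i _; rewrite coef_D (Hx _ (ltn_ord i)) mul0r.
Qed.

Lemma null_deriv p : null p -> null p^`().
Proof.
by move=> np i; apply: (aeS _ (np i.+1)) => x Hx; rewrite coef_deriv rmorphMn /= Hx mul0rn.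
Qed.

Lemma null_ext_D zeta p : null p -> ae x, ext_D zeta x p = 0.
Proof.
move=> np; apply: (aeS2 _ (null_D np) (null_iota (null_deriv np))) => x H1 H2.
by rewrite /ext_D H1 H2 mul0r addr0.
Qed.

Lemma ext_dersys zeta :
  (forall p, (ae x, ev_iota x p = 0) -> ae x, ext_D zeta x p = 0) ->
  dersys ext_iota (ext_D zeta).
Proof. by move=> K; split; [exact: ext_DD|exact: ext_DM|exact: K]. Qed.

Lemma ext_dersys_transcendental :
  (forall p, (ae x, ev_iota x p = 0) -> null p) ->
  dersys ext_iota (ext_D (fun=> 0)).
Proof. by move=> K; apply: ext_dersys => p /K; exact: null_ext_D. Qed.

(** A non-null polynomial [P] of least size vanishing at [z] acts as a minimal polynomial; in
    characteristic 0 it is separable, so P'(z) can be inverted almost everywhere. *)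
Lemma ext_dersys_algebraic p0 : (ae x, ev_iota x p0 = 0) -> ~ null p0 ->
  exists zeta, dersys ext_iota (ext_D zeta).
Proof.
move=> z0 n0.
pose alg (m : nat) :=
  `[< exists p, [/\ ae x, ev_iota x p = 0, ~ null p & size p = m] >].
have ex : exists m, alg m by exists (size p0); apply/asboolP; exists p0.
have [m /asboolP[P [zP nP sP]] min] := ex_minnP ex.
have minP r : (ae x, ev_iota x r = 0) -> (size r < size P)%N -> null r.
  move=> zr sr; apply: contrapT => nr.
  have /min : alg (size r) by apply/asboolP; exists r.
  by rewrite leqNgt -sP sr.
have P0 : P != 0.
  by apply/eqP => P0; apply: nP => i; rewrite P0 coef0; apply: filterE => x; rewrite rmorph0.
set c := lead_coef P.
have cn : ae x, iota x c <> 0.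
  (* Were the leading coefficient negligible, dropping the leading term would leave a shorter
     polynomial vanishing at [z]; that one is null, and then so is [P]. *)
  have [cz|//] := ultra_or (fun x => iota x c = 0); exfalso; apply: nP.
  pose Q := P - c *: 'X^((size P).-1).
  have sP0 : (0 < size P)%N by rewrite size_poly_gt0.
  have coefQ i : Q`_i = if i == (size P).-1 then 0 else P`_i.
    rewrite coefB coefZ coefXn; case: eqP => [->|_]; last by rewrite mulr0 subr0.
    by rewrite mulr1 /c lead_coefE subrr.
  have nQ : null Q.
    apply: minP.
      apply: (aeS2 _ zP cz) => x H1 H2; rewrite /Q /ev_iota rmorphB /= map_polyZ hornerD hornerN.
      by rewrite hornerZ /= H2 mul0r subr0.
    rewrite -[X in (_ < X)%N](prednK sP0) ltnS; apply/leq_sizeP => i Pi.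
    rewrite coefQ; case: eqP => // /eqP ne.
    by rewrite nth_default // -(prednK sP0) ltn_neqAle eq_sym ne.
  move=> i; have := nQ i; rewrite coefQ; case: eqP => [->|//] _.
  by move: cz; rewrite /c lead_coefE.
have sP1 : (1 < size P)%N.
  rewrite ltnNge; apply/negP => sP1; have [c0 Pc] : exists c0, P = c0%:P.
    by exists P`_0; exact: size1_polyC.
  apply: nP => -[|i]; rewrite Pc coefC /=; last by apply: filterE => x; rewrite rmorph0.
  by apply: (aeS _ zP) => x; rewrite Pc /ev_iota map_polyC hornerC.
have dP : ae x, ev_iota x P^`() <> 0.
  have [dz|//] := ultra_or (fun x => ev_iota x P^`() = 0); exfalso.
  (* By minimality the derivative would be null, but its top coefficient is a positive integer
     multiple of [c]. *)
  have nd := minP _ dz (lt_size_deriv P0) (size P).-2.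
  have [x [H1 H2]] := filter_ex (aeI cn nd).
  apply: H1; move: H2; rewrite /= coef_deriv prednK; last by rewrite -subn1 subn_gt0.
  by rewrite -lead_coefE rmorphMn /= => /eqP; rewrite mulrn_eq0; case: eqP => [E|_ /eqP//];
    move: sP1; rewrite -subn_gt0 subn1 E.
(* The value of the derivation at z is forced by P(z) = 0. *)
pose zeta x := - ev_D x P / ev_iota x P^`().
exists zeta; apply: ext_dersys => p zp.
have DP : ae x, ext_D zeta x P = 0.
  apply: (aeS _ dP) => x /eqP dPx; rewrite /ext_D /zeta mulrC divfK // subrr.
  by [].
(* Pseudo-division, because [c] need not be invertible in [A]. The remainder is null, so
   differentiating the identity leaves a power of [c] times the derivative of [p], equal to 0. *)
have [k q r E sr] := Pdiv.ComRing.redivpP p P.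
have {}sr := sr P0.
have zr : ae x, ev_iota x r = 0.
  apply: (aeS2 _ zp zP) => x H1 H2.
  have := congr1 (ev_iota x) E.
  rewrite /ev_iota map_polyZ rmorphD rmorphM hornerZ hornerD hornerM /=.
  by move: H1 H2; rewrite /ev_iota => -> ->; rewrite !mulr0 add0r.
have Dr := null_ext_D zeta (minP _ zr sr).
apply: (aeS2 _ (aeI cn zp) (aeI zP (aeI DP Dr))).
move=> x [cx zpx] [zPx [DPx Drx]].
have := congr1 (ext_D zeta x) E.
rewrite -mul_polyC ext_DM ext_DD ext_DM zpx zPx DPx Drx !mul0r mulr0 !addr0.
rewrite /ev_iota map_polyC hornerC /= rmorphXn => /eqP.
rewrite mulf_eq0 expf_eq0 => /orP[/andP[_ /eqP]//|/eqP//].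
Qed.

Lemma extend_dersys : exists (zeta : X -> R), dersys ext_iota (ext_D zeta).
Proof.
have [[p [zp np]]|H] := pselect (exists p, (ae x, ev_iota x p = 0) /\ ~ null p).
  exact: ext_dersys_algebraic zp np.
exists (fun=> 0); apply: ext_dersys_transcendental => p zp.
by apply: contrapT => np; apply: H; exists p.
Qed.

End Extension.

Lemma tower_dersys (A : comNzRingType) (iota : X -> {rmorphism A -> R}) (D : X -> A -> R)
    (zs : seq (X -> R)) : dersys iota D ->
  exists (B : comNzRingType) (iotaB : X -> {rmorphism B -> R}) (DB : X -> B -> R) (j : A -> B),
    [/\ dersys iotaB DB, forall x a, iotaB x (j a) = iota x a, forall x a, DB x (j a) = D x a &
      forall z, List.In z zs -> exists b, forall x, iotaB x b = z x].
Proof.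
elim: zs A iota D => [|z zs IH] A iota D HA; first by exists A, iota, D, id.
have [zeta Hz] := extend_dersys HA z.
have [B [iB [DB [j [HB jI jD jz]]]]] := IH _ _ _ Hz.
exists B, iB, DB, (j \o polyC); split=> // [x a|x a|u].
- by rewrite /= jI /= /horner_eval map_polyC hornerC.
- rewrite /= jD /ext_D derivC /ev_iota rmorph0 horner0 mul0r addr0 /ev_D.
  have -> : map_poly (D x) a%:P = (D x a)%:P.
    by apply/polyP => i; rewrite (coef_D HA) !coefC; case: eqP => // _; exact: dersys0 HA x.
  by rewrite hornerC.
- case=> [<-|/jz//]; exists (j 'X) => x.
  by rewrite jI /= /horner_eval map_polyX hornerX.
Qed.

End Derivations.

(** * From a linear relation between differentials to the Nash property *)

Section KahlerToNash.
Context {R : realType} {n : nat}.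
Local Notation Rn := 'rV[R]_n.
Local Notation mp := (mpoly.mpoly n R).
Context (U : set Rn) (oU : open U) (cU : connected U) (U0 : U !=set0).
Local Notation Et := (Et_alg U).
Implicit Types (p q : sa_car Et).

(** Equivalent to containing a dense open subset of [U]; in this form finite intersections are
    obtained by nesting. *)
Definition densely (A : set Rn) := forall V, open V -> V `<=` U -> V !=set0 ->
  exists W, [/\ open W, W `<=` V, W !=set0 & forall x, W x -> A x].

Lemma densely_proper : ProperFilter densely.
Proof.
apply: Build_ProperFilter.
  move=> H; have [W [_ _ [w Ww] /(_ w Ww)]] := H U oU (@subset_refl _ U) U0.
  by [].
split.
- by move=> V oV VU V0; exists V; split.
- move=> A B HA HB V oV VU V0.
  have [W1 [oW1 W1V W10 HW1]] := HA V oV VU V0.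
  have [W2 [oW2 W2W1 W20 HW2]] := HB W1 oW1 (subset_trans W1V VU) W10.
  exists W2; split=> //; first exact: subset_trans W1V.
  by move=> x Wx; split; [exact/HW1/W2W1|exact: HW2].
- move=> A B AB HA V oV VU V0; have [W [oW WV W0 HW]] := HA V oV VU V0.
  by exists W; split=> // x /HW /AB.
Qed.

Lemma densely_U : densely U.
Proof. by move=> V oV VU V0; exists V; split. Qed.

Lemma densely_nonzero h : analytic_on U h -> (exists x, U x /\ h x != 0) ->
  densely (fun x => h x != 0).
Proof. by move=> ah hx V oV VU V0; exact: (analytic_nonzero_open oU cU ah hx). Qed.

Context (f : Rn -> R) (af : analytic_on U f).

Definition iota0 (x : Rn) : {rmorphism {poly mp} -> R} :=
  horner_eval (f x) \o map_poly (mpoly.meval (fun i => x ord0 i)).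

Lemma iota0E x P : iota0 x P = pevl P f x.
Proof. by []. Qed.

(** Well-definedness is where the failure of the Nash property enters: for nonzero [P] the analytic
    function P(x, f) is then not identically zero, hence nonzero on a set of [G]. *)
Lemma base_dersys (G : set_system Rn) : ProperFilter G -> densely `<=` G -> ~ nash_on U f ->
  dersys G iota0 (fun x P => pevl P^`() f x).
Proof.
move=> GP dG nf; split=> [x P Q|x P Q|P].
- by rewrite derivD -!iota0E rmorphD.
- rewrite derivM -!iota0E rmorphD !rmorphM /= -!/(iota0 x _); ring.
- move=> GP0; suff -> : P = 0 by apply: filterE => x; rewrite deriv0 pevl0.
  apply: contrapT => /eqP P0; apply: nf; split=> //; exists P => // x Ux.
  apply: contrapT => /eqP Px.
  have : G (fun x => pevl P f x != 0).
    apply: dG; apply: densely_nonzero; first exact: analytic_pevl.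
    by exists x.
  by move=> /(filterI GP0) /filter_ex[y [/= /eqP ->]].
Qed.

Lemma fval_eqv_ae (G : set_system Rn) p q : ProperFilter G -> densely `<=` G ->
  sa_mem Et p -> sa_mem Et q -> sa_eqv Et p q -> G (fun x => fval x p = fval x q).
Proof.
move=> GP dG [_ Sp] [_ Sq] [t [St H]].
have nz s : nash_S U s -> G (fun x => s x != 0).
  by move=> [[as_ _] sx]; apply: dG; exact: densely_nonzero.
apply: filterS (filterI (dG _ densely_U) (filterI (nz _ St) (filterI (nz _ Sp) (nz _ Sq)))).
move=> x [Ux [tx [px qx]]]; have /eqP := H x Ux.
rewrite mulf_eq0 (negbTE tx) /= subr_eq0 => /eqP E.
by apply/eqP; rewrite /fval eqr_div // E.
Qed.

Lemma ae_In (G : set_system Rn) (T : Type) (l : seq T) (P : T -> Rn -> Prop) :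
  ProperFilter G -> (forall t, List.In t l -> G (P t)) ->
  G (fun x => forall t, List.In t l -> P t x).
Proof.
move=> GP; elim: l => [|t l IH] H; first by apply: filterE => x t [].
have Hl : G (fun x => forall t, List.In t l -> P t x) by apply: IH => u ul; apply: H; right.
apply: filterS (filterI (H t (or_introl erefl)) Hl) => x [H1 H2] u [<-//|]; exact: H2.
Qed.

(** Only these values are adjoined; the sums, multiples and products in the relations are then
    represented by ring operations. *)
Definition kgen_args (e : @kgen R (sa_car Et)) : seq (sa_car Et) :=
  match e with KAdd h k => [:: h; k] | KScal _ h => [:: h] | KMul h k => [:: h; k] end.

Lemma linear_kahler_nash (fi : 'I_n -> sa_car Et) : (forall i, sa_mem Et (fi i)) ->
  kahler_eq (fs_d (to_Et U f))
    (fs_sum [seq fs_scale (fi i) (fs_d (to_Et U (xcoord i))) | i <- enum 'I_n]) ->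
  nash_on U f.
Proof.
move=> mfi [rs [mrs w0]]; apply: contrapT => nf.
set w := fs_sub _ (fs_sum [seq fs_scale _.1 _ | _ <- _]) in w0.
have [G [UG dG]] := ultraFilterLemma densely_proper.
have GP : ProperFilter G by exact: ultra_proper.
have nz s : nash_S U s -> G (fun x => s x != 0).
  by move=> [[as_ _] sx]; apply: dG; exact: densely_nonzero.
pose zs := [seq (fun x => fval x p) | p <- flatten [seq kgen_args r.2 | r <- rs]].
have aeE (P : Rn -> Prop) : (forall x, P x) -> G P by move=> H; exact: filterE.
have [A [iA [DA [j [HA jI jD jz]]]]] := tower_dersys zs (base_dersys GP dG nf).
(* xget depends only on the set rep p, so almost everywhere equal fractions have
   the same tau at every point. *)
pose rep p := [set b : A | G (fun x => iA x b = fval x p)].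
pose tau x p := DA x (xget 0 (rep p)).
have tau_rep p b : G (fun x => iA x b = fval x p) -> G (fun x => tau x p = DA x b).
  move=> Hb; have Hc : rep p (xget 0 (rep p)) by apply: xgetPex; exists b.
  have : G (fun x => iA x (xget 0 (rep p) - b) = 0).
    by apply: (aeS2 _ Hb Hc) => x H1 H2; rewrite rmorphB /= H1 H2 subrr.
  move=> /(dersys_ker HA); apply: filterS => x E.
  by rewrite /tau -[xget 0 _](subrK b) (dersysD HA) E add0r.
have tauE p q : sa_mem Et p -> sa_mem Et q -> sa_eqv Et p q -> forall x, tau x p = tau x q.
  move=> mp mq pq x; rewrite /tau; congr (DA x (xget 0 _)).
  have E := fval_eqv_ae GP dG mp mq pq.
  by apply/seteqP; split=> b Hb; apply: (aeS2 _ Hb E) => y ->.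
pose Q1 (p : sa_car Et) := G (fun x => p.2 x != 0).
have Q1M p q : Q1 p -> Q1 q -> Q1 (sa_mul Et p q).
  by move=> Hp Hq; apply: (aeS2 _ Hp Hq) => x; exact: mulf_neq0.
have Q1N p : Q1 p -> Q1 (sa_opp Et p) by [].
have Q1c a : Q1 (to_Et U a) by apply: filterE => x; exact: oner_neq0.
have memx i : sa_mem Et (to_Et U (xcoord i)) by apply: to_Et_mem => //; exact: smooth_coord.
have memf : sa_mem Et (to_Et U f) by apply: to_Et_mem => //; exact: analytic_smooth.
have wall : fs_all Q1 (sa_mem Et) w.
  apply: (@fs_all_relations _ Et _ _ Q1M Q1N (Q1c _)).
    apply: (@fs_all_linear _ Et _ _ Q1M Q1N (Q1c _) _ _ _ _ _ memf _ memx) => i.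
    by have [_] := mfi i; exact: nz.
  move=> r /mrs[[_ Sr] kr]; split; first exact: nz.
  apply: (@fs_all_kgen _ Et _ _ Q1M Q1N (Q1c _) _ _ _ _ _ kr).
  - by move=> c; exact: Q1c.
  - by move=> a [_]; exact: nz.
  - by move=> h k mh mk; split; [exact: mh|exact: Et_memD|exact: Et_memM].
  - by move=> c h mh; exact: Et_memZ.
have dens : G (fun x => forall t, List.In t w -> t.1.2 x != 0).
  by apply: ae_In => t /wall[].
have coef0 : G (fun x => forall t, List.In t w -> pairing (fval x) (delta t.2) w = 0).
  apply: ae_In => t tw; have [_ mt] := wall _ tw; have [s [Ss Hs]] := w0 _ mt.
  apply: filterS (filterI (dG _ densely_U) (filterI (nz _ Ss) dens)) => x [Ux [sx dx]].
  have [_ <-] := fval_fs_coef t.2 dx.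
  have := Hs x Ux; rewrite /= mulr1 mul0r subr0 => /eqP; rewrite mulf_eq0 (negbTE sx) /=.
  by move=> /eqP c0; rewrite /fval c0 mul0r.
have pair0 : G (fun x => pairing (fval x) (tau x) w = 0).
  apply: filterS coef0 => x Hx.
  pose mem p := exists t, List.In t w /\ t.2 = p.
  have memE p : mem p -> sa_mem Et p by move=> [t [/wall[_ mt] <-]].
  have := @grouping R (sa_car Et) mem (sa_eqv Et) [seq (fval x t.1, t.2) | t <- w] (tau x).
  rewrite big_map; apply.
  - move=> p _; exists (fun=> 1); split; first exact: nash_S_one.
    by move=> y _; rewrite subrr mulr0.
  - move=> p q [s [Ss H]]; exists s; split=> // y Uy.
    by have := H y Uy; rewrite -opprB mulrN => /eqP; rewrite oppr_eq0 => /eqP.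
  - move=> p q u /memE[_ Sq] [s [Ss Hs]] [t [St Ht]].
    (* Chaining the two equalities cross-multiplies by the denominator of the middle fraction, so it
       joins the multipliers. *)
    exists (fun y => s y * t y * q.2 y); split.
      by apply: nash_S_mul => //; exact: nash_S_mul.
    move=> y Uy; have := Hs y Uy; have := Ht y Uy.
    move: (p.1 y) (p.2 y) (q.1 y) (q.2 y) (u.1 y) (u.2 y) (s y) (t y) => p1 p2 q1 q2 u1 u2 s1 t1 E1 E2.
    rewrite (_ : _ * _ = u2 * t1 * (s1 * (p1 * q2 - q1 * p2)) +
      p2 * s1 * (t1 * (q1 * u2 - u1 * q2))); last by ring.
    by rewrite E1 E2 !mulr0 addr0.
  - by move=> p q /memE mp /memE mq pq; exact: tauE.
  - by move=> u uw; have [t [<- tw]] := In_map uw; exists t.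
  - by move=> _ [t [tw <-]]; rewrite big_map; exact: Hx.
have tauf : G (fun x => tau x (to_Et U f) = 1).
  apply: (aeS _ (tau_rep (to_Et U f) (j 'X) _)) => [x ->|].
    by rewrite jD derivX /pevl rmorph1 hornerC.
  by apply: filterE => x; rewrite jI iota0E /pevl map_polyX hornerX fval_to_Et.
have taux : G (fun x => forall i, List.In i (enum 'I_n) -> tau x (to_Et U (xcoord i)) = 0).
  apply: ae_In => i _.
  apply: (aeS _ (tau_rep (to_Et U (xcoord i)) (j (mpoly.mpolyX R (mpoly.mnm1 i))%:P) _)) => [x ->|].
    by rewrite jD derivC pevl0.
  apply: filterE => x; rewrite jI iota0E /pevl map_polyC hornerC fval_to_Et.
  by rewrite /= mpoly.mevalXU.
have args e p : List.In p (kgen_args e) -> (exists r, List.In r rs /\ r.2 = e) ->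
    exists b, forall x, iA x b = fval x p.
  move=> pe [r [rrs re]]; apply: jz; apply/List.in_map_iff; exists p; split=> //.
  apply/List.in_concat; exists (kgen_args e); split=> //.
  by apply/List.in_map_iff; exists r; rewrite re.
have tauk : G (fun x => forall r, List.In r rs -> pairing (fval x) (tau x) (kgen_elem r.2) = 0).
  apply: ae_In => -[a e] rrs; have [_ /= me] := mrs _ rrs; have {}args := args e.
  have pk x := @pairing_kgen _ Et (fval x) (tau x) (@fvalM _ _ U x) (@fvalN _ _ U x) (fval1 U x)
    (@fvalZ _ _ U x) e.
  have er : exists r, List.In r rs /\ r.2 = e by exists (a, e).
  case: e me args pk er {rrs} => [h k [mh mk]|c h mh|h k [mh mk]] args pk er.
  - have [b Hb] := args h (or_introl erefl) er.
    have [d Hd] := args k (or_intror (or_introl erefl)) er.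
    have Th := tau_rep h b (aeE _ Hb); have Tk := tau_rep k d (aeE _ Hd).
    have Thk : G (fun x => tau x (sa_add Et h k) = DA x (b + d)).
      apply: tau_rep; apply: (aeS2 _ (nz _ mh.2) (nz _ mk.2)) => x hx kx.
      by rewrite rmorphD Hb Hd /fval /= addf_div.
    apply: (aeS _ (aeI Th (aeI Tk Thk))) => x [E1 [E2 E3]].
    by rewrite /= pk E1 E2 E3 (dersysD HA) subrr.
  - have [b Hb] := args h (or_introl erefl) er.
    have Th := tau_rep h b (aeE _ Hb).
    pose c0 := j (mpoly.mpolyC n c)%:P.
    have c0I x : iA x c0 = c.
      by rewrite jI iota0E /pevl map_polyC hornerC /= mpoly.mevalC.
    have c0D x : DA x c0 = 0 by rewrite jD derivC pevl0.
    have Tc : G (fun x => tau x (sa_scal Et c h) = DA x (c0 * b)).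
      by apply: tau_rep; apply: filterE => x; rewrite rmorphM c0I Hb fvalZ.
    apply: (aeS _ (aeI Th Tc)) => x [E1 E2].
    by rewrite /= pk E1 E2 (dersysM HA) c0I c0D mulr0 addr0 subrr.
  - have [b Hb] := args h (or_introl erefl) er.
    have [d Hd] := args k (or_intror (or_introl erefl)) er.
    have Th := tau_rep h b (aeE _ Hb); have Tk := tau_rep k d (aeE _ Hd).
    have Thk : G (fun x => tau x (sa_mul Et h k) = DA x (b * d)).
      by apply: tau_rep; apply: filterE => x; rewrite rmorphM Hb Hd fvalM.
    apply: (aeS _ (aeI Th (aeI Tk Thk))) => x [E1 [E2 E3]].
    by rewrite /= pk E1 E2 E3 (dersysM HA) Hb Hd subrr.
(* One common point suffices: there the functional gives 1 on [df] and 0 on every [dx_i] and every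
   relation, although it vanishes on [w]. *)
have [x [E0 [Ef [Ex Ek]]]] := filter_ex (filterI pair0 (filterI tauf (filterI taux tauk))).
have M := @fvalM _ _ U x; have N := @fvalN _ _ U x; have F1 := fval1 U x.
have := E0; rewrite /w pairing_sub // pairing_sub // pairing_d // !pairing_sum Ef.
rewrite (eq_big_In (G := fun=> 0)) => [|i ie]; last first.
  by rewrite pairing_scale // pairing_d // Ex // mulr0.
rewrite (eq_big_In (s := rs) (G := fun=> 0)) => [|r re]; last first.
  by rewrite pairing_scale // Ek // mulr0.
by rewrite !big1 // !subr0 => /eqP; rewrite oner_eq0.
Qed.

End KahlerToNash.

Theorem theorem2p1 (R : realType) (n : nat) (U : set 'rV[R]_n) (f : 'rV[R]_n -> R) :
  semialgebraic U -> open U -> connected U -> U !=set0 ->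
  analytic_on U f ->
  let c1 := nash_on U f in
  let c2 := exists g : 'rV[R]_n -> R,
      nash_S U g /\
      kahler_zero (A := E_alg U)
        (fs_scale (A := E_alg U) g (fs_sub (A := E_alg U) (fs_d (A := E_alg U) f)
           (fs_sum [seq fs_scale (A := E_alg U) (partial i f) (fs_d (A := E_alg U) (xcoord i)) | i <- enum 'I_n]))) in
  let c3 := kahler_eq (A := Et_alg U) (fs_d (to_Et U f))
      (fs_sum [seq fs_scale (to_Et U (partial i f)) (fs_d (to_Et U (xcoord i)))
              | i <- enum 'I_n]) in
  let c4 := exists fi : 'I_n -> sa_car (Et_alg U),
      (forall i, sa_mem (Et_alg U) (fi i)) /\
      kahler_eq (A := Et_alg U) (fs_d (to_Et U f))
        (fs_sum [seq fs_scale (fi i) (fs_d (to_Et U (xcoord i))) | i <- enum 'I_n]) in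
  (c1 <-> c2) /\ (c1 <-> c3) /\ (c1 <-> c4).
Proof.
move=> _ oU cU U0 af c1 c2 c3 c4.
have sf : smooth_on U f by exact: analytic_smooth.
have c12 : c1 -> c2.
  move=> nf; have [g [Sg kg]] := nash_omega oU U0 nf; exists g; split=> //.
  by apply/kahler_zeroE; apply: kzero_ext kg => h0 x _; rewrite coefs_omega.
have c23 : c2 -> c3 by move=> [g [Sg kg]]; exact: localize_kahler kg.
have c34 : c3 -> c4.
  move=> H; exists (fun i => to_Et U (partial i f)); split=> // i.
  by apply: to_Et_mem => //; exact: smooth_partial.
have c41 : c4 -> c1 by move=> [fi [mfi H]]; exact: linear_kahler_nash H.
by split; [|split]; split; auto.
Qed.
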